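(* For every fixed $\alpha\in(0,1)$ and $K=n^\alpha$, w.h.p. as $n\to\infty$, $$\Psi^{\mathrm{Bern}(1/2)}_K=\frac{K^2}{4}+\frac{K^{3/2}\sqrt{\log(n/K)}}{2}+o\left(K^{3/2}\sqrt{\log n}\right).$$
   Context: $K=n^\alpha$ is regarded as an integer, i.e. $K=\lfloor n^\alpha\rfloor$. Let $Z_{ij}$, $1\le i<j\le n$, be i.i.d. Bernoulli$(1/2)$ random variables (edge indicators of the Erd\H{o}s--R\'enyi graph $\mathbb{G}(n,1/2)$). For $S\subset\{1,\dots,n\}$ let $Z_S=\sum_{1\le i<j\le n,\ i,j\in S}Z_{ij}$ and $$\Psi^{\mathrm{Bern}(1/2)}_K=\max_{S\subset\{1,\dots,n\},\,|S|=K}Z_S .$$ ''W.h.p.'' means with probability tending to $1$; the statement with the $o(f_n)$ term means that for every $\varepsilon>0$ the absolute difference between the left-hand side and the explicit terms is at most $\varepsilon f_n$ with probability tending to $1$. *)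

(* Defs.v *)
From HB Require Import structures.
From mathcomp Require Import all_boot all_order all_algebra.
From mathcomp Require Import all_classical all_reals all_analysis.

Set Implicit Arguments.
Unset Strict Implicit.
Unset Printing Implicit Defensive.

Import Order.TTheory GRing.Theory Num.Theory.
Import numFieldNormedType.Exports.

Local Open Scope classical_set_scope.
Local Open Scope ring_scope.

(* Mutual (not merely pairwise) independence of a finite family: the product
   rule is required for every subfamily J. *)
Definition mutually_independent (d d' : measure_display)
    (T : measurableType d) (T' : measurableType d') (R : realType)
    (P : probability T R) (I : finType) (X : I -> {RV P >-> T'}) : Prop :=
  forall (J : {set I}) (A : I -> set T'),
    (forall i, i \in J -> measurable (A i)) ->
    P (\bigcap_(i in [set i | i \in J]) (X i @^-1` A i)) =
    (\prod_(i in J) P (X i @^-1` A i))%E.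

Definition iid_bernoulli (d : measure_display) (T : measurableType d)
    (R : realType) (P : probability T R) (I : finType) (p : R)
    (X : I -> {RV P >-> bool}) : Prop :=
  (forall i (A : set bool), distribution P (X i) A = bernoulli_prob p A) /\
  mutually_independent X.

(* Pairs i < j, with vertices numbered from 0 to n - 1. *)
Definition edge (n : nat) : finType :=
  {e : 'I_n * 'I_n | (e.1 < e.2)%N}.

Definition edge_count (n : nat) (z : edge n -> bool) (S : {set 'I_n}) : nat :=
  (\sum_(e : edge n | ((sval e).1 \in S) && ((sval e).2 \in S)) z e)%N.

(* The maximum is 0 when n < K, as no S has K elements then. *)
Definition Psi (n K : nat) (z : edge n -> bool) : nat :=
  (\max_(S : {set 'I_n} | #|S| == K) edge_count z S)%N.

Definition subset_size (R : realType) (alpha : R) (n : nat) : nat :=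
  Num.truncn (n%:R `^ alpha).

(* Main.v *)
Require Import Defs.
From HB Require Import structures.
From mathcomp Require Import all_boot all_order all_algebra.
From mathcomp Require Import all_classical all_reals all_analysis.
From mathcomp Require Import ring lra zify.

(** Write [m = 'C(K, 2)] and [L = ln (n / K)].  As the edge indicators are
    independent fair bits, every probability in the statement is an average over
    the finite cube [{ffun edge n -> bool}] ([prob_avg]).

    Upper bound.  A fixed [S] satisfies [Z_S >= m / 2 + t] with probability at
    most [exp (- 2 t^2 / m)], by Chernoff's method and [cosh x <= exp (x^2 / 2)].
    There are at most [exp (K (L + 1))] sets [S], so the union bound becomes
    effective just above [t = K^(3/2) sqrt L / 2] ([Psi_upper]).

    Lower bound.  Let [N] count the sets [S] with [Z_S >= m / 2 + t], for [t] at
    the same threshold, so that [2 t^2 / m] is [K L].  If [S] and [S'] share [o]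
    vertices, hence [q = 'C(o, 2)] edges, both reach the level with probability
    at most [exp (- 4 t^2 / (m + q))].  Compared with independent events this is
    a gain of [exp (2 K L q / (m + q))], which is at most [exp (o L) = (n / K)^o]
    because [2 x^2 / (1 + x^2) <= x] for [x = o / K] ([overlap_exponent]).  The
    sum of [(n / K)^o] over all [S'] is at most [2^K 'C(n, K)] ([sum_overlap]):
    large overlaps are rare enough to pay for their correlation, for every
    exponent [alpha].  The second moment method then shows that the level is
    reached, but only with a probability of the form [exp (- o(K ln n))]
    ([Psi_lower_prob], [Psi_reaches_level]).

    This weak bound suffices because the maximum is concentrated:
    [P (Psi <= a) P (Psi >= b) <= exp (lam^2 m - lam (b - a))] for small [lam]
    ([max_concentration]).  With [b - a] of order [eps K^(3/2) sqrt (ln n)] and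
    the best [lam], the right-hand side is [exp (- c eps^2 K ln n)].  It beats
    the lower bound on [P (Psi >= b)], so [P (Psi <= a)] tends to 0
    ([Psi_lower]).  The concentration inequality is a form of the convex
    concentration inequality of Talagrand and Maurey; for maxima of linear forms
    it follows by induction on the coordinates ([exp_infconv_cube]). *)

Import Order.TTheory GRing.Theory Num.Theory.
Import numFieldNormedType.Exports.

Local Open Scope classical_set_scope.
Local Open Scope ring_scope.

Set Implicit Arguments.
Unset Strict Implicit.
Unset Printing Implicit Defensive.

(** * Exponential inequalities *)

Lemma expR_convex_comb_le (R : realType) (t p q : R) : 0 <= t -> t <= 1 ->
  expR ((1 - t) * p + t * q) <= (1 - t) * expR p + t * expR q.
Proof.
move=> t0 t1; set r := _ + _.
have tangent x : expR r * (1 + (x - r)) <= expR x.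
  have -> : expR x = expR r * expR (x - r) by rewrite -expRD; congr expR; ring.
  by rewrite ler_wpM2l ?expR_ge0// expR_ge1Dx.
have -> : expR r = (1 - t) * (expR r * (1 + (p - r)))
                   + t * (expR r * (1 + (q - r))) by rewrite /r; ring.
by apply: lerD; apply: ler_wpM2l; rewrite ?subr_ge0.
Qed.

Lemma mulr_coshB_sinh_ge0 (R : realType) (x : R) : 0 <= x ->
  0 <= x * (expR x + expR (- x)) - (expR x - expR (- x)).
Proof.
move=> x0; pose f (x : R) := x * (expR x + expR (- x)) - (expR x - expR (- x)).
have df (y : R) : is_derive y 1 f (y * (expR y - expR (- y))).
  rewrite /f; apply: is_derive_eq.
  by rewrite /GRing.scale/=; ring.
have -> : 0 = f 0 by rewrite /f mul0r oppr0 subrr subr0.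
have : {in `[0, x] &, {homo f : x y / x <= y}}.
  apply: (@ger0_derive1_le _ f 0 x) => [y _|y|].
  - exact: ex_derive.
  - rewrite in_itv/= => /andP[y0 _]; rewrite derive1E derive_val.
    by rewrite mulr_ge0 ?(ltW y0)// subr_ge0 ler_expR; lra.
  - apply: derivable_within_continuous => y _; exact: ex_derive.
by apply; rewrite ?in_itv/= ?lexx ?x0.
Qed.

(** The derivative of [cosh x * exp (- x^2 / 2)] has the sign of
    [sinh x - x * cosh x]. *)
Lemma cosh_le (R : realType) (x : R) :
  (expR x + expR (- x)) / 2 <= expR (x ^+ 2 / 2).
Proof.
wlog x0 : x / 0 <= x.
  move=> h; have [/h//|/ltW x0] := leP 0 x.
  by have := h (- x); rewrite opprK sqrrN [expR (- x) + _]addrC; apply; rewrite oppr_ge0.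
pose f (x : R) := (expR x + expR (- x)) * expR (- (x ^+ 2 / 2)).
have df (y : R) : is_derive y 1 f
    (- (y * (expR y + expR (- y)) - (expR y - expR (- y))) * expR (- (y ^+ 2 / 2))).
  rewrite /f; apply: is_derive_eq.
  by rewrite /GRing.scale/=; field.
have : {in `[0, x] &, {homo f : x y /~ x <= y}}.
  apply: (@ler0_derive1_le _ f 0 x) => [y _|y|].
  - exact: ex_derive.
  - rewrite in_itv/= => /andP[y0 _]; rewrite derive1E derive_val.
    by rewrite mulNr oppr_le0 mulr_ge0 ?expR_ge0// mulr_coshB_sinh_ge0 ?ltW.
  - apply: derivable_within_continuous => y _; exact: ex_derive.
move=> /(_ x 0); rewrite !in_itv/= !lexx x0 => /(_ isT isT isT).
have -> : f 0 = 2 by rewrite /f expr0n/= mul0r oppr0 expR0 mulr1.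
by rewrite /f [expR (- (_ / _))]expRN ler_pdivrMr ?expR_gt0// ler_pdivrMr// mulrC.
Qed.

(** The one-dimensional case of the concentration inequality, for a function
    whose values at the two points differ by [d].  Both factors are an
    exponential times a hyperbolic cosine; after [cosh_le] the exponents cancel
    to second order in [d]. *)
Lemma two_point_le1 (R : realType) (d : R) : 0 <= d -> d <= 1 ->
  (expR (d - d ^+ 2) + 1) / 2 * ((expR (- d) + 1) / 2) <= 1.
Proof.
move=> d0 d1.
set u := (d - d ^+ 2) / 2; set v := d / 2.
have -> : (expR (d - d ^+ 2) + 1) / 2 = expR u * ((expR u + expR (- u)) / 2).
  rewrite mulrA mulrDr -!expRD subrr expR0; congr ((expR _ + _) / _).
  by rewrite /u; field.
have -> : (expR (- d) + 1) / 2 = expR (- v) * ((expR v + expR (- v)) / 2).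
  rewrite mulrA mulrDr -!expRD addNr expR0 [1 + _]addrC; congr ((expR _ + _) / _).
  by rewrite /v; field.
apply: (@le_trans _ _ (expR u * expR (u ^+ 2 / 2) * (expR (- v) * expR (v ^+ 2 / 2)))).
  have pos (x : R) : 0 <= (expR x + expR (- x)) / 2.
    by rewrite divr_ge0// addr_ge0 ?expR_ge0.
  apply: ler_pM; rewrite ?mulr_ge0 ?pos ?expR_ge0//;
    by rewrite ler_wpM2l ?expR_ge0// cosh_le.
rewrite -!expRD expR_le1 /u /v.
have : d ^+ 2 * (1 - d) ^+ 2 <= d ^+ 2.
  by rewrite ler_piMr ?sqr_ge0// expr_le1 ?subr_ge0// lerBlDr lerDl.
have := sqr_ge0 d.
by nra.
Qed.

(** * Averages over the discrete cube *)

Definition avg (R : realType) (I : finType) (F : {ffun I -> bool} -> R) : R :=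
  (\sum_z F z) / 2 ^+ #|I|.

Lemma avgD (R : realType) (I : finType) (F G : {ffun I -> bool} -> R) :
  avg (fun z => F z + G z) = avg F + avg G.
Proof. by rewrite /avg big_split/= mulrDl. Qed.

Lemma avgZ (R : realType) (I : finType) (a : R) (F : {ffun I -> bool} -> R) :
  avg (fun z => a * F z) = a * avg F.
Proof. by rewrite /avg -mulr_sumr mulrA. Qed.

Lemma avg_sum (R : realType) (I J : finType) (Q : pred J)
    (F : J -> {ffun I -> bool} -> R) :
  avg (fun z => \sum_(j | Q j) F j z) = \sum_(j | Q j) avg (F j).
Proof. by rewrite /avg exchange_big/= mulr_suml. Qed.

Lemma le_avg (R : realType) (I : finType) (F G : {ffun I -> bool} -> R) :
  (forall z, F z <= G z) -> avg F <= avg G.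
Proof.
by move=> FG; rewrite /avg ler_wpM2r ?invr_ge0 ?exprn_ge0// ler_sum.
Qed.

Lemma avg_cst (R : realType) (I : finType) (a : R) :
  avg (fun _ : {ffun I -> bool} => a) = a.
Proof.
rewrite /avg sumr_const card_ffun card_bool -[a *+ _]mulr_natr natrX.
by rewrite mulfK// expf_neq0// pnatr_eq0.
Qed.

Lemma avg_ge0 (R : realType) (I : finType) (F : {ffun I -> bool} -> R) :
  (forall z, 0 <= F z) -> 0 <= avg F.
Proof. by move=> F0; rewrite -(avg_cst I (0 : R)) le_avg. Qed.

Lemma avg_prod (R : realType) (I : finType) (h : I -> bool -> R) :
  avg (fun z : {ffun I -> bool} => \prod_i h i (z i))
  = \prod_i ((h i true + h i false) / 2).
Proof.
rewrite /avg -(bigA_distr_bigA h) [RHS]big_split/= prodr_const exprVn.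
congr (_ / _).
by apply: eq_bigr => i _; rewrite big_bool.
Qed.

Definition upd (I : finType) (z : {ffun I -> bool}) (e : I) (b : bool) :
    {ffun I -> bool} := [ffun i => if i == e then b else z i].

Lemma updC (I : finType) (z : {ffun I -> bool}) (e e' : I) (b b' : bool) :
  e != e' -> upd (upd z e b) e' b' = upd (upd z e' b') e b.
Proof.
move=> ee'; apply/ffunP => i; rewrite !ffunE.
by case: eqVneq => // ->; rewrite eq_sym (negbTE ee').
Qed.

(** Average over the coordinates listed in [s], the other ones being those of
    [z].  Inductions on the dimension of the cube become inductions on [s]. *)
Fixpoint cavg (R : realType) (I : finType) (s : seq I)
    (F : {ffun I -> bool} -> R) (z : {ffun I -> bool}) : R :=
  if s is e :: s' then
    (cavg s' F (upd z e true) + cavg s' F (upd z e false)) / 2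
  else F z.

Lemma cavg_upd (R : realType) (I : finType) (s : seq I) e b
    (F : {ffun I -> bool} -> R) z : e \notin s ->
  cavg s F (upd z e b) = cavg s (fun w => F (upd w e b)) z.
Proof.
elim: s z => [//|i s IHs] z /=; rewrite inE negb_or => /andP[ei es].
by rewrite !(updC z _ _ ei) !IHs.
Qed.

Lemma le_cavg (R : realType) (I : finType) (s : seq I)
    (F G : {ffun I -> bool} -> R) z :
  (forall w, F w <= G w) -> cavg s F z <= cavg s G z.
Proof.
move=> FG; elim: s z => [//|i s IHs] z /=.
by rewrite ler_wpM2r ?invr_ge0// lerD.
Qed.

Lemma cavgD (R : realType) (I : finType) (s : seq I)
    (F G : {ffun I -> bool} -> R) z :
  cavg s (fun w => F w + G w) z = cavg s F z + cavg s G z.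
Proof.
elim: s z => [//|i s IHs] z /=; rewrite !IHs -mulrDl; congr (_ / _).
by rewrite addrACA.
Qed.

Lemma cavgZ (R : realType) (I : finType) (s : seq I) (a : R)
    (F : {ffun I -> bool} -> R) z :
  cavg s (fun w => a * F w) z = a * cavg s F z.
Proof.
by elim: s z => [//|i s IHs] z /=; rewrite !IHs -mulrDr mulrA.
Qed.

Lemma cavg_gt0 (R : realType) (I : finType) (s : seq I)
    (F : {ffun I -> bool} -> R) z :
  (forall w, 0 < F w) -> 0 < cavg s F z.
Proof.
by move=> F0; elim: s z => [//|i s IHs] z /=; rewrite divr_gt0 ?addr_gt0.
Qed.

Lemma cavg_agree (R : realType) (I : finType) (s : seq I)
    (F : {ffun I -> bool} -> R) (z z' : {ffun I -> bool}) :
  (forall i, i \notin s -> z i = z' i) -> cavg s F z = cavg s F z'.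
Proof.
elim: s z z' => [|e s IHs] z z' zz' /=.
  by congr F; apply/ffunP => i; apply: zz'.
congr ((_ + _) / _); apply: IHs => i si; rewrite !ffunE;
  by case: eqVneq => // ie; apply: zz'; rewrite inE negb_or ie.
Qed.

(** Averaging over the coordinate [e] symmetrizes [F] under the bijection that
    flips [e]. *)
Lemma sum_cavg (R : realType) (I : finType) (s : seq I)
    (F : {ffun I -> bool} -> R) : \sum_z cavg s F z = \sum_z F z.
Proof.
elim: s => [//|e s IHs] /=; rewrite -mulr_suml -IHs; set G := cavg s F.
pose flip (z : {ffun I -> bool}) := upd z e (~~ z e).
have flipK : involutive flip.
  move=> z; apply/ffunP => i; rewrite !ffunE eqxx negbK.
  by case: eqVneq => // ->.
have -> : \sum_z (G (upd z e true) + G (upd z e false))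
          = \sum_z (G z + G (flip z)).
  apply: eq_bigr => z _.
  have updz : upd z e (z e) = z.
    by apply/ffunP => i; rewrite ffunE; case: eqVneq => // ->.
  rewrite /flip -[in G z]updz.
  by case: (z e) => //=; rewrite addrC.
rewrite big_split/= -[\sum_z G (flip z)](reindex_inj (inv_inj flipK) (P := xpredT)).
by rewrite -[_ + _]mulr2n -[_ *+ 2]mulr_natr mulfK// pnatr_eq0.
Qed.

Lemma avgE (R : realType) (I : finType) (F : {ffun I -> bool} -> R) z :
  avg F = cavg (enum I) F z.
Proof.
rewrite -[RHS](avg_cst I) /avg -(sum_cavg (enum I) F).
by congr (_ / _); apply: eq_bigr => w _; apply: cavg_agree => i; rewrite mem_enum.
Qed.

(** By independence, all patterns of values of the [X i] have the same
    probability. *)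
Lemma prob_avg d (T : measurableType d) (R : realType) (P : probability T R)
    (I : finType) (X : I -> {RV P >-> bool}) (p : pred {ffun I -> bool}) :
  iid_bernoulli 2^-1 X ->
  P [set w | p [ffun i => X i w]] = (avg (fun z => (p z)%:R : R))%:E.
Proof.
move=> [Xb Xind].
pose at_ (z : {ffun I -> bool}) : set T :=
  \bigcap_(i in [set i | i \in [set: I]%SET]) (X i @^-1` [set z i]).
have at_E z w : at_ z w <-> [ffun i => X i w] = z.
  split=> [h|<- i _]; last by rewrite /= ffunE.
  by apply/ffunP => i; rewrite ffunE; apply: h; rewrite /= inE.
have mat z : measurable (at_ z).
  apply: fin_bigcap_measurable; first exact: finite_finset.
  by move=> i _; rewrite -[X in measurable X]setTI; apply: measurable_funP.
have Pat z : P (at_ z) = ((2 ^+ #|I|)^-1)%:E.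
  rewrite /at_ Xind; last by move=> i _.
  transitivity (\prod_(i in [set: I]%SET) (2^-1 : R)%:E)%E.
    apply: eq_bigr => i _.
    have := Xb i [set z i]; rewrite /distribution /pushforward => ->.
    rewrite bernoulli_probE; last by rewrite invr_ge0 ler0n invf_le1// ler1n.
    rewrite !diracE; case: (z i).
      by rewrite mem_set// memNset//= mule1 mule0 adde0.
    rewrite memNset// mem_set//= mule0 mule1 add0e; congr EFin.
    rewrite -[LHS]/(1 - 2^-1); lra.
  rewrite prodEFin prodr_const cardsT exprVn//.
have -> : [set w | p [ffun i => X i w]] = \bigcup_(z in [set` p]) at_ z.
  apply/seteqP; split => [w pw|w [z pz /at_E /= ->//]].
  by exists [ffun i => X i w] => //; apply/at_E.
rewrite measure_fin_bigcup//; last first.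
  by move=> z z' _ _ [w [/at_E <- /at_E]].
rewrite -(@bigfs _ _ _ _ (index_enum _))//; first last.
- by move=> z _; rewrite mem_index_enum.
- exact: index_enum_uniq.
rewrite (eq_bigr (fun=> ((2 ^+ #|I|)^-1)%:E)) => [|z _]; last exact: Pat.
rewrite sumEFin /avg mulr_suml; congr EFin.
rewrite [LHS]big_mkcond/=; apply: eq_bigr => z _.
by case: (p z); rewrite ?mul1r ?mul0r.
Qed.

(** * Concentration of maxima of linear forms *)

Definition rmax (R : realType) (J : finType) (Q : pred J) (j0 : J) (F : J -> R) : R :=
  \big[Num.max/F j0]_(j | Q j) F j.

Lemma le_rmax (R : realType) (J : finType) (Q : pred J) (j0 : J) (F : J -> R) j :
  Q j -> F j <= rmax Q j0 F.
Proof. by move=> Qj; rewrite /rmax (le_bigmax_cond (F j0) F Qj). Qed.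

Lemma rmax_le (R : realType) (J : finType) (Q : pred J) (j0 : J) (F : J -> R) a :
  Q j0 -> (forall j, Q j -> F j <= a) -> rmax Q j0 F <= a.
Proof. by move=> Qj0 Fa; apply: bigmax_le => //; exact: Fa. Qed.

Definition linear_form (R : realType) (I J : finType) (B : J -> {set I})
    (lam : R) (j : J) (z : {ffun I -> bool}) : R :=
  lam * \sum_(i in B j) (z i)%:R.

(** The squared norm of the part of the [j]-th linear form that is supported by
    the coordinates in [s]. *)
Definition sqr_norm (R : realType) (I J : finType) (B : J -> {set I})
    (lam : R) (s : seq I) (j : J) : R :=
  lam ^+ 2 * \sum_(i <- s) (i \in B j)%:R.

Lemma linear_form_upd (R : realType) (I J : finType) (B : J -> {set I})
    (lam : R) (j : J) (z : {ffun I -> bool}) (e : I) :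
  linear_form B lam j (upd z e true) =
  linear_form B lam j (upd z e false) + lam * (e \in B j)%:R.
Proof.
rewrite /linear_form -mulrDr; congr (_ * _).
have [eB|eB] := boolP (e \in B j).
  rewrite !(bigD1 e eB)/= !ffunE eqxx addrC add0r; congr (_ + _).
  by apply: eq_bigr => i /andP[_ /negbTE ie]; rewrite !ffunE ie.
rewrite addr0; apply: eq_bigr => i iB; rewrite !ffunE.
by case: eqVneq => // ie; rewrite -ie iB in eB.
Qed.

(** Maurey's inequality [E (exp (Q f)) * E (exp (- f)) <= 1], where [Q f] is the
    infimal convolution of [f] with [|x|^2 / 4], for the maximum [f] of the
    linear forms.  For a linear form this convolution is
    [linear_form - sqr_norm], and [Q] is monotone, so that the maximum in the
    first factor is a lower bound of [Q f].  Fixing one more coordinate [e] produces two problems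
    of the same kind, for which the bound is known; they are recombined with
    weights [1 - t] and [t] through the convexity of the exponential, and
    completing a square absorbs the contribution of [e] to [sqr_norm]. *)
Lemma exp_infconv_cube (R : realType) (I J : finType) (Q : pred J) (j0 : J)
    (B : J -> {set I}) (lam : R) (s : seq I) (z : {ffun I -> bool}) :
  Q j0 -> 0 <= lam -> lam <= 1 / 2 -> uniq s ->
  cavg s (fun w => expR (rmax Q j0
    (fun j => linear_form B lam j w - sqr_norm B lam s j))) z *
  cavg s (fun w => expR (- rmax Q j0 (fun j => linear_form B lam j w))) z <= 1.
Proof.
move=> Qj0 lam0 lam1; pose lin := linear_form B lam; pose pen := sqr_norm B lam.
rewrite -/lin -/pen.
elim: s z => [|e s IHs] z /=.
  move=> _; rewrite -expRD expR_le1 subr_le0; apply: rmax_le => // j Qj.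
  by rewrite /pen /sqr_norm big_nil mulr0 subr0 (le_rmax j0 (fun j => lin j z)).
move=> /andP[es us].
set f := fun w => rmax Q j0 (fun j => lin j w).
set g := fun w => rmax Q j0 (fun j => lin j w - pen s j).
set h := fun w => rmax Q j0 (fun j => lin j w - pen (e :: s) j).
set H := fun b => cavg s (fun w => expR (- f w)) (upd z e b).
set G := fun b => cavg s (fun w => expR (g w)) (upd z e b).
have HE b : H b = cavg s (fun w => expR (- f (upd w e b))) z by apply: cavg_upd.
have GE b : G b = cavg s (fun w => expR (g (upd w e b))) z by apply: cavg_upd.
have H0 b : 0 < H b by apply: cavg_gt0 => w; apply: expR_gt0.
have GH b : G b * H b <= 1 by apply: IHs.
pose a := - ln (H true); pose b := - ln (H false).
have Ha : H true = expR (- a) by rewrite /a opprK lnK// posrE.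
have Hb : H false = expR (- b) by rewrite /b opprK lnK// posrE.
have Ga : G true <= expR a.
  by have := GH true; rewrite Ha expRN ler_pdivrMr ?expR_gt0// mul1r.
have Gb : G false <= expR b.
  by have := GH false; rewrite Hb expRN ler_pdivrMr ?expR_gt0// mul1r.
pose d := a - b.
(* The maximum increases with the coordinate [e], by at most [lam]. *)
have d0 : 0 <= d.
  rewrite /d subr_ge0 -lerN2 -ler_expR -Ha -Hb !HE; apply: le_cavg => w.
  rewrite ler_expR lerN2; apply: rmax_le => // j Qj.
  apply: le_trans (le_rmax j0 _ Qj); rewrite /lin linear_form_upd lerDl.
  by rewrite mulr_ge0.
have dlam : d <= lam.
  rewrite /d lerBlDr -lerN2 opprD -ler_expR expRD -Ha -Hb !HE -cavgZ.
  apply: le_cavg => w.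
  rewrite -expRD ler_expR -opprD lerN2; apply: rmax_le => // j Qj.
  rewrite /lin linear_form_upd addrC; apply: lerD;
    last exact: (le_rmax j0 (fun j => lin j _)).
  by rewrite ler_piMr//; case: (_ \in _).
have d1 : d <= 1 / 2 := le_trans dlam lam1.
have hfalse : cavg s (fun w => expR (h w)) (upd z e false) <= expR b.
  apply: le_trans Gb; apply: le_cavg => w; rewrite ler_expR.
  apply: rmax_le => // j Qj; apply: le_trans (le_rmax j0 _ Qj).
  rewrite lerB// /pen /sqr_norm big_cons mulrDr lerDr mulr_ge0 ?sqr_ge0//.
have htrue : cavg s (fun w => expR (h w)) (upd z e true) <= expR (a - d ^+ 2).
  (* This weight makes the exponents [(1 - t) a + t b + d^2] add up to
     [a - d^2]; it is at most 1 because [lam <= 1 / 2]. *)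
  pose t := 2 * d.
  have t0 : 0 <= t by rewrite /t mulr_ge0.
  have t1 : t <= 1 by rewrite /t; lra.
  have key w : h (upd w e true) <=
      (1 - t) * g (upd w e true) + t * g (upd w e false) + d ^+ 2.
    apply: rmax_le => // j Qj.
    have g1 := le_rmax j0 (fun j => lin j (upd w e true) - pen s j) Qj.
    have g2 := le_rmax j0 (fun j => lin j (upd w e false) - pen s j) Qj.
    have g1' := ler_wpM2l (_ : 0 <= 1 - t) g1.
    have g2' := ler_wpM2l t0 g2.
    rewrite -/(g _) in g1' g2'.
    have {}g1' : _ := g1' ltac:(by rewrite subr_ge0).
    apply: le_trans (lerD (lerD g1' g2') (lexx _)).
    rewrite /lin linear_form_upd -/lin /pen /sqr_norm big_cons mulrDr.
    set l := lin _ _; set p := _ * \sum_(_ <- _) _.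
    have : 0 <= (lam * (e \in B j)%:R - d) ^+ 2 by apply: sqr_ge0.
    have -> : lam ^+ 2 * (e \in B j)%:R = (lam * (e \in B j)%:R) ^+ 2.
      by case: (e \in B j); rewrite ?mulr1// !mulr0 expr0n.
    set u := lam * _; rewrite /t => u0; lra.
  rewrite cavg_upd//.
  pose c := expR (a - d ^+ 2).
  apply: (@le_trans _ _ (cavg s (fun w => c * ((1 - t) * (expR (- a) * expR (g (upd w e true)))
     + t * (expR (- b) * expR (g (upd w e false))))) z)).
    apply: le_cavg => w; rewrite -!expRD.
    apply: (@le_trans _ _ (c * expR ((1 - t) * (- a + g (upd w e true))
                                     + t * (- b + g (upd w e false))))).
      rewrite /c -expRD ler_expR; apply: le_trans (key w) _.
      rewrite /t /d; lra.
    by rewrite ler_wpM2l ?expR_ge0//; apply: expR_convex_comb_le.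
  rewrite cavgZ cavgD !cavgZ -GE -GE ler_piMr ?expR_ge0//.
  have A1 : expR (- a) * G true <= 1 by rewrite -Ha mulrC GH.
  have A0 : expR (- b) * G false <= 1 by rewrite -Hb mulrC GH.
  have := ler_wpM2l t0 A0.
  have := ler_wpM2l (_ : 0 <= 1 - t) A1; rewrite subr_ge0 => /(_ t1); lra.
rewrite -/(H true) -/(H false) Ha Hb.
apply: le_trans (_ : (expR (a - d ^+ 2) + expR b) / 2 * ((expR (- a) + expR (- b)) / 2) <= _).
  by rewrite ler_wpM2r ?divr_ge0 ?addr_ge0 ?expR_ge0// ler_wpM2r// lerD.
have := @two_point_le1 R d d0 (le_trans d1 _).
have -> : expR (a - d ^+ 2) = expR b * expR (d - d ^+ 2).
  by rewrite -expRD; congr expR; rewrite /d; ring.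
have -> : expR (- a) = expR (- b) * expR (- d).
  by rewrite -expRD; congr expR; rewrite /d; ring.
have eb : expR b * expR (- b) = 1 by rewrite -expRD subrr expR0.
set x := expR (d - _); set y := expR (- d); move=> xy.
have -> : (expR b * x + expR b) / 2 * ((expR (- b) * y + expR (- b)) / 2)
  = expR b * expR (- b) * ((x + 1) / 2 * ((y + 1) / 2)) by field.
rewrite eb mul1r; apply: xy; lra.
Qed.

Definition ones (I : finType) (A : {set I}) (z : {ffun I -> bool}) : nat :=
  (\sum_(i in A) z i)%N.

Lemma avg_chernoff (R : realType) (I : finType) (p : pred {ffun I -> bool})
    (X : {ffun I -> bool} -> R) (t : R) :
  (forall z, p z -> t <= X z) -> avg (fun z => (p z)%:R) <= expR (- t) * avg (fun z => expR (X z)).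
Proof.
move=> pX; rewrite -avgZ; apply: le_avg => z; rewrite -expRD.
have [/pX tX|_] := boolP (p z); last by rewrite expR_ge0.
by rewrite -[1%:R]expR0 ler_expR addrC subr_ge0.
Qed.

(** Both tails at once: the infimal convolution lowers each linear form of norm
    at most [lam * sqrt m] by at most [lam^2 * m], so [exp_infconv_cube] bounds
    the product of the exponential moments of the maximum at [lam] and
    [- lam]. *)
Lemma max_concentration (R : realType) (I J : finType) (Q : pred J)
    (A : J -> {set I}) (m : nat) (lam a b : R) :
  (exists j, Q j) -> (forall j, Q j -> (#|A j| <= m)%N) -> 0 <= lam -> lam <= 1 / 2 ->
  avg (fun z => ((\max_(j | Q j) ones (A j) z)%:R <= a :> R)%:R) *
  avg (fun z => (b <= (\max_(j | Q j) ones (A j) z)%:R :> R)%:R)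
  <= expR (lam ^+ 2 * m%:R - lam * (b - a)).
Proof.
move=> [j0 Qj0] Am lam0 lam1; pose f z := (\max_(j | Q j) ones (A j) z)%N.
have linE j z : linear_form A lam j z = lam * (ones (A j) z)%:R.
  by rewrite /linear_form /ones natr_sum.
have fE z : exists2 j, Q j & f z = ones (A j) z.
  have [|j] := @eq_bigmax_cond _ [pred j | Q j] (fun j => ones (A j) z).
    by apply/card_gt0P; exists j0.
  by move=> /= Qj fj; exists j.
have P1 : avg (fun z => ((f z)%:R <= a :> R)%:R) <=
   expR (lam * a) * avg (fun z => expR (- rmax Q j0 (fun j => linear_form A lam j z))).
  rewrite -[lam * a]opprK; apply: avg_chernoff => z fa; rewrite lerN2.
  apply: rmax_le => // j Qj; rewrite linE ler_wpM2l//; apply: le_trans fa.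
  by rewrite ler_nat; apply: leq_bigmax_cond (Qj).
have P2 : avg (fun z => (b <= (f z)%:R :> R)%:R) <= expR (- (lam * b - lam ^+ 2 * m%:R)) *
   avg (fun z => expR (rmax Q j0 (fun j => linear_form A lam j z - sqr_norm A lam (enum I) j))).
  apply: avg_chernoff => z bf; have [j Qj fj] := fE z.
  apply: le_trans (le_rmax j0 _ Qj); rewrite linE; apply: lerB.
    by rewrite ler_wpM2l// -fj.
  rewrite /sqr_norm ler_wpM2l ?sqr_ge0// big_enum/= -natr_sum ler_nat.
  by rewrite -big_mkcond/= sum1_card Am.
have avg0 (F : {ffun I -> bool} -> R) : (forall z, 0 <= F z) -> 0 <= avg F by apply: avg_ge0.
apply: le_trans (ler_pM _ _ P1 P2) _; rewrite ?avg0//.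
set X := avg _; set Y := avg _.
have -> : expR (lam * a) * X * (expR (- (lam * b - lam ^+ 2 * m%:R)) * Y)
  = expR (lam ^+ 2 * m%:R - lam * (b - a)) * (Y * X).
  rewrite mulrACA -expRD [X * Y]mulrC; congr (expR _ * _); ring.
rewrite ler_piMr ?expR_ge0//.
rewrite /X /Y !(avgE _ [ffun=> false]).
by apply: exp_infconv_cube => //; exact: enum_uniq.
Qed.

(** * Tail bounds and the second moment method on the cube *)

(** Each factor is [cosh (c i / 2) <= exp (c i ^+ 2 / 8)]. *)
Lemma avg_expR_le (R : realType) (I : finType) (c : I -> R) :
  avg (fun z : {ffun I -> bool} => expR (\sum_i c i * ((z i)%:R - 1 / 2)))
  <= expR (\sum_i c i ^+ 2 / 8).
Proof.
have -> : (fun z : {ffun I -> bool} => expR (\sum_i c i * ((z i)%:R - 1 / 2)))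
   = (fun z => \prod_i expR (c i * ((z i)%:R - 1 / 2))).
  by apply/funext => z; rewrite expR_sum.
rewrite (avg_prod (fun i b => expR (c i * ((b : bool)%:R - 1 / 2)))) expR_sum.
apply: ler_prod => i _; rewrite divr_ge0 ?addr_ge0 ?expR_ge0//=.
apply: le_trans (_ : expR ((c i / 2) ^+ 2 / 2) <= _); last first.
  by rewrite ler_expR; lra.
apply: le_trans (cosh_le _); rewrite ler_wpM2r ?invr_ge0//.
by apply: lerD; rewrite ler_expR /=; lra.
Qed.

(** Chernoff's method applied to the sum of the two counts, in which common
    coordinates have weight 2.  The case [A = B] is the usual tail bound for one
    count. *)
Lemma avg_two_tails (R : realType) (I : finType) (A B : {set I}) (m : nat) (t : R) :
  #|A| = m -> #|B| = m -> (0 < m)%N -> 0 <= t ->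
  avg (fun z => ((m%:R / 2 + t <= (ones A z)%:R) && (m%:R / 2 + t <= (ones B z)%:R))%:R)
  <= expR (- (4 * t ^+ 2 / (m + #|A :&: B|)%:R)).
Proof.
move=> Am Bm m0 t0; set q := #|_ :&: _|.
have mq0 : 0 < (m + q)%:R :> R by rewrite ltr0n addn_gt0 m0.
(* The minimizer of [lam^2 (m + q) / 4 - 2 lam t]. *)
pose lam : R := 4 * t / (m + q)%:R.
have lam0 : 0 <= lam by rewrite /lam divr_ge0 ?mulr_ge0// ltW.
pose c i : R := lam * ((i \in A)%:R + (i \in B)%:R).
have sumc (z : I -> R) : \sum_i c i * z i = lam * (\sum_(i in A) z i + \sum_(i in B) z i).
  rewrite mulrDr !mulr_sumr [X in _ = X + _]big_mkcond.
  rewrite [X in _ = _ + X]big_mkcond -big_split/=; apply: eq_bigr => i _.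
  by rewrite /c; case: (_ \in A); case: (_ \in B) => /=; ring.
have sumc2 : \sum_i c i ^+ 2 / 8 = lam ^+ 2 * (m + q)%:R / 4.
  have -> : (m + q)%:R = \sum_i ((i \in A)%:R + (i \in B)%:R) ^+ 2 / 2 :> R.
    rewrite -mulr_suml.
    have -> : \sum_i ((i \in A)%:R + (i \in B)%:R) ^+ 2
      = \sum_i (i \in A)%:R + \sum_i (i \in B)%:R + 2 * \sum_i (i \in A :&: B)%:R :> R.
      rewrite mulr_sumr -!big_split/=; apply: eq_bigr => i _; rewrite inE.
      by case: (_ \in A); case: (_ \in B) => /=; ring.
    have card (C : {set I}) : \sum_i (i \in C)%:R = #|C|%:R :> R.
      by rewrite -natr_sum -big_mkcond/= sum1_card.
    rewrite !card Am Bm -/q natrD; by field.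
  rewrite mulr_sumr mulr_suml; apply: eq_bigr => i _; rewrite /c; by field.
apply: le_trans (avg_chernoff (X := fun z => \sum_i c i * ((z i)%:R - 1 / 2)) (t := 2 * lam * t) _) _.
  move=> z /andP[zA zB].
  have -> : \sum_i c i * ((z i)%:R - 1 / 2) = lam * ((ones A z)%:R - m%:R / 2 + ((ones B z)%:R - m%:R / 2)).
    have -> : \sum_i c i * ((z i)%:R - 1 / 2) = \sum_i c i * (z i)%:R - \sum_i c i * (1 / 2).
      by rewrite -sumrB; apply: eq_bigr => i _; rewrite mulrBr.
    rewrite (sumc (fun i => (z i)%:R)) (sumc (fun _ => 1 / 2)) /ones !natr_sum.
    rewrite !sumr_const Am Bm -[(1 / 2) *+ m]mulr_natr; by field.
  by rewrite -mulrA mulrCA ler_wpM2l//; lra.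
apply: le_trans (ler_wpM2l (expR_ge0 _) (avg_expR_le _)) _.
rewrite -expRD ler_expR sumc2 /lam le_eqVlt; apply/orP; left; apply/eqP; field.
by rewrite -natrD lt0r_neq0.
Qed.

Lemma max_upper_tail (R : realType) (I J : finType) (Q : pred J)
    (A : J -> {set I}) (m : nat) (t : R) :
  (forall j, Q j -> #|A j| = m) -> (0 < m)%N -> 0 < t ->
  avg (fun z => (m%:R / 2 + t <= (\max_(j | Q j) ones (A j) z)%:R :> R)%:R)
  <= #|[pred j | Q j]|%:R * expR (- (2 * t ^+ 2 / m%:R)).
Proof.
move=> Am m0 t0.
apply: (@le_trans _ _ (avg (fun z : {ffun I -> bool} =>
    \sum_(j | Q j) (m%:R / 2 + t <= (ones (A j) z)%:R :> R)%:R : R))).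
  apply: le_avg => z.
  have [tm|_] := boolP (_ + t <= _); last by apply: sumr_ge0.
  have Q0 : (0 < #|[pred j | Q j]|)%N.
    rewrite lt0n; apply/negP => /eqP/card0_eq Q0; move: tm.
    by rewrite big_pred0// leNgt ltr_pwDr// divr_ge0.
  have [j Qj jE] := @eq_bigmax_cond _ [pred j | Q j] (fun j => ones (A j) z) Q0.
  rewrite (bigD1 j)//= -[X in X <= _]addr0; apply: lerD; last by rewrite sumr_ge0.
  by rewrite jE in tm; rewrite tm.
rewrite avg_sum -sum1_card natr_sum mulr_suml.
rewrite [leRHS](eq_bigl Q) => [|j]; last by rewrite inE.
apply: ler_sum => j Qj; rewrite mul1r.
have := avg_two_tails (Am j Qj) (Am j Qj) m0 (ltW t0).
have -> : 4 * t ^+ 2 / (m + #|A j :&: A j|)%:R = 2 * t ^+ 2 / m%:R.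
  by rewrite finset.setIid Am// addnn -muln2 natrM; field; rewrite pnatr_eq0 -lt0n m0.
apply: le_trans; apply: le_avg => z.
by rewrite andbb.
Qed.

(** Cauchy-Schwarz, applied to the number [N] of events [E j] that occur and the
    indicator [U] of [0 < N], in the form of [0 <= E ((N - c U)^2)] for the best
    [c]. *)
Lemma second_moment (R : realType) (I J : finType) (Q : pred J)
    (E : J -> pred {ffun I -> bool}) :
  0 < avg (fun z => \sum_(j | Q j) (E j z)%:R : R) ->
  avg (fun z => \sum_(j | Q j) (E j z)%:R) ^+ 2 <=
  avg (fun z => [exists j, Q j && E j z]%:R) *
  (\sum_(j | Q j) \sum_(k | Q k) avg (fun z => (E j z && E k z)%:R)) :> R.
Proof.
set N := fun z => \sum_(j | Q j) (E j z)%:R : R.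
set U := fun z => [exists j, Q j && E j z]%:R : R.
set V := \sum_(j | _) _ => N0.
have VE : V = avg (fun z => N z ^+ 2).
  rewrite /V /N.
  have -> : (fun z => (\sum_(j | Q j) (E j z)%:R) ^+ 2)
          = (fun z => \sum_(j | Q j) \sum_(k | Q k) (E j z && E k z)%:R : R).
    apply/funext => z; rewrite expr2 mulr_suml; apply: eq_bigr => j _.
    rewrite mulr_sumr; apply: eq_bigr => k _.
    by case: (E j z); case: (E k z); rewrite ?mulr0 ?mulr1.
  by rewrite avg_sum; apply: eq_bigr => j _; rewrite avg_sum.
have NU z : N z = 0 \/ U z = 1.
  rewrite /N /U; case: existsP => [_|nE]; [by right|left].
  rewrite big1// => j Qj; case: (boolP (E j z)) => // Ej; case: nE.
  by exists j; rewrite Qj.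
have U0 z : 0 <= U z by [].
have key (c : R) : 2 * c * avg N <= V + c ^+ 2 * avg U.
  rewrite VE -!avgZ -avgD; apply: le_avg => z.
  case: (NU z) => ->; first by rewrite mulr0 expr0n add0r mulr_ge0 ?sqr_ge0.
  by rewrite mulr1 -subr_ge0; have := sqr_ge0 (N z - c); lra.
have [u0|] := ltP 0 (avg U); last first.
  move=> u0; have uz : avg U = 0 by apply/eqP; rewrite eq_le u0 avg_ge0.
  have := key (V / avg N); rewrite uz mulr0 addr0 -mulrA divfK ?gt_eqF//.
  have V0 : 0 < V.
    have := key 1; rewrite uz mulr0 addr0; move: N0; lra.
  by move: V0; lra.
have := key (avg N / avg U).
have -> : 2 * (avg N / avg U) * avg N = 2 * (avg N ^+ 2 / avg U) by field; rewrite gt_eqF.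
have -> : (avg N / avg U) ^+ 2 * avg U = avg N ^+ 2 / avg U by field; rewrite gt_eqF.
move=> h; rewrite mulrC -ler_pdivrMr//; lra.
Qed.

(** * Edges, overlaps and binomial coefficients *)

Definition inner (n : nat) (S : {set 'I_n}) : {set edge n} :=
  [set e : edge n | ((sval e).1 \in S) && ((sval e).2 \in S)].

Lemma innerI (n : nat) (S S' : {set 'I_n}) :
  inner S :&: inner S' = inner (S :&: S').
Proof. by apply/setP => e; rewrite !inE andbACA. Qed.

Lemma card_inner (n : nat) (S : {set 'I_n}) : #|inner S| = 'C(#|S|, 2).
Proof.
rewrite -cards_draws.
pose f (e : edge n) : {set 'I_n} := [set (sval e).1; (sval e).2]%SET.
have -> : [set A : {set 'I_n} | (A \subset S) && (#|A| == 2)]%SET = f @: inner S.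
  apply/setP => A; rewrite inE; apply/andP/imsetP => [[AS /cards2P[x [y [xy AE]]]]|[[[x y] /= xy]]].
    move: AS; rewrite AE finset.subUset !finset.sub1set => /andP[xS yS].
    have [lt_xy|lt_yx|/val_inj exy] := ltngtP x y; last by rewrite exy eqxx in xy.
      by exists (exist _ (x, y) lt_xy) => //; rewrite inE/= xS yS.
    by exists (exist _ (y, x) lt_yx); rewrite ?inE/= ?xS ?yS// /f/= finset.setUC.
  rewrite inE /= => /andP[xS yS] ->.
  rewrite finset.subUset !finset.sub1set xS yS cards2; split=> //.
  by have [exy|//] := eqVneq x y; rewrite exy ltnn in xy.
rewrite card_in_imset// => -[[x y] /= xy] [[x' y'] /= xy'] _ _ /=.
rewrite /f /= => /setP eqS; apply: val_inj => /=.
have := eqS x; have := eqS y; have := eqS x'; have := eqS y'.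
rewrite !inE !eqxx ?orbT/=.
have nxy : (x == y) = false by apply/eqP => exy; rewrite exy ltnn in xy.
have nxy' : (x' == y') = false by apply/eqP => exy; rewrite exy ltnn in xy'.
move=> /orP[/eqP e1|/eqP e1] /orP[/eqP e2|/eqP e2] _ _; subst.
- by rewrite eqxx in nxy'.
- by have := ltn_trans xy xy'; rewrite ltnn.
- by [].
- by rewrite eqxx in nxy'.
Qed.

Lemma edge_countE (n : nat) (z : {ffun edge n -> bool}) (S : {set 'I_n}) :
  edge_count z S = ones (inner S) z.
Proof. by rewrite /edge_count /ones; apply: eq_bigl => e; rewrite inE. Qed.

Lemma card_supersets (n K : nat) (A : {set 'I_n}) : (#|A| <= K)%N -> (K <= n)%N ->
  (#|[set S : {set 'I_n} | (#|S| == K) && (A \subset S)]%SET| = 'C(n - #|A|, K - #|A|))%N.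
Proof.
move=> AK Kn.
have -> : (n - #|A|)%N = #|~: A| by rewrite [RHS]finset.cardsCs finset.setCK card_ord.
rewrite -cards_draws.
rewrite -(@card_in_imset _ _ (fun S : {set 'I_n} => S :\: A)); last first.
  move=> S S'; rewrite !inE => /andP[_ AS] /andP[_ AS'] eqD.
  by rewrite -(finset.setID S A) -(finset.setID S' A) eqD (finset.setIidPr AS) (finset.setIidPr AS').
congr #|pred_of_set _|; apply/setP => D; rewrite !inE.
apply/imsetP/andP => [[S]|[DA /eqP DK]].
  rewrite inE => /andP[/eqP SK AS] ->; split.
    by apply/fintype.subsetP => i; rewrite !inE => /andP[].
  by rewrite cardsD (finset.setIidPr AS) SK.
exists (D :|: A).
  rewrite inE finset.subsetUr andbT cardsU DK.
  have -> : D :&: A = finset.set0.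
    by apply/eqP; rewrite finset.setI_eq0 finset.disjoints_subset.
  by rewrite cards0 subn0 subnK.
rewrite finset.setDUl finset.setDv finset.setU0; apply/setP => i; rewrite !inE.
by case: (boolP (i \in D)) => [/(fintype.subsetP DA)|]; rewrite ?inE ?andbF// => ->.
Qed.

(** A uniform [K]-subset contains [a] given points with probability at most
    [(K / n) ^ a]. *)
Lemma bin_ratio (n K a : nat) : (a <= K)%N -> (K <= n)%N ->
  ('C(n - a, K - a) * n ^ a <= 'C(n, K) * K ^ a)%N.
Proof.
elim: a => [|a IHa] aK Kn; first by rewrite !subn0 !muln1.
have {}IHa := IHa (ltnW aK) Kn.
have step : ('C(n - a.+1, K - a.+1) * n <= 'C(n - a, K - a) * K)%N.
  have := mul_bin_diag (n - a) (K - a.+1).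
  have -> : (K - a.+1).+1 = (K - a)%N by rewrite subnSK.
  have -> : (n - a).-1 = (n - a.+1)%N by rewrite subnS.
  have na : (0 < n - a)%N by rewrite subn_gt0 (leq_trans aK).
  set x := 'C(_, _); set y := 'C(_, _) => xy.
  rewrite -(leq_pmul2l na) mulnA xy -mulnA mulnC -mulnA [leqRHS]mulnCA leq_mul2l.
  apply/orP; right; nia.
rewrite !expnS mulnA; apply: leq_trans (leq_mul step (leqnn (n ^ a))) _.
by rewrite mulnAC [leqRHS]mulnCA mulnC leq_mul2l IHa orbT.
Qed.

(** Grouping the sets [S'] by their intersection [A] with [S] and using
    [bin_ratio], each of the [2 ^ K] subsets [A] contributes at most
    [(n / K) ^ #|A| * (K / n) ^ #|A| * 'C(n, K)]. *)
Lemma sum_overlap (R : realType) (n K : nat) (S : {set 'I_n}) :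
  (0 < K)%N -> (K <= n)%N -> #|S| = K ->
  \sum_(S' : {set 'I_n} | #|S'| == K) (n%:R / K%:R) ^+ #|S :&: S'|
  <= 2 ^+ K * 'C(n, K)%:R :> R.
Proof.
move=> K0 Kn SK.
have K0R : 0 < K%:R :> R by rewrite ltr0n.
have n0R : 0 < n%:R :> R by rewrite ltr0n (leq_trans K0).
rewrite (partition_big (fun S' => S :&: S') [pred A | A \in powerset S])/=; last first.
  by move=> S' _; rewrite inE finset.subsetIl.
have -> : 2 ^+ K * 'C(n, K)%:R = \sum_(A | A \in powerset S) 'C(n, K)%:R :> R.
  by rewrite sumr_const card_powerset SK -[RHS]mulr_natl natrX.
apply: ler_sum => A; rewrite inE => AS.
apply: (@le_trans _ _ (\sum_(S' : {set 'I_n} | (#|S'| == K) && (A \subset S')) (n%:R / K%:R) ^+ #|A|)).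
  rewrite (eq_bigr (fun=> (n%:R / K%:R) ^+ #|A|)); last first.
    by move=> S' /andP[_ /eqP ->].
  rewrite big_mkcond [leRHS]big_mkcond/=; apply: ler_sum => S' _.
  case: (#|S'| == K) => //=; case: eqP => [<-|_]; first by rewrite finset.subsetIr.
  by case: ifP => // _; rewrite exprn_ge0// divr_ge0// ltW.
have AK : (#|A| <= K)%N by rewrite -SK subset_leq_card.
rewrite (eq_bigl [in [set S' : {set 'I_n} | (#|S'| == K) && (A \subset S')]%SET]);
  last by move=> S'; rewrite inE.
rewrite sumr_const card_supersets// -[leLHS]mulr_natl.
rewrite expr_div_n mulrA ler_pdivrMr ?exprn_gt0// -!natrX -!natrM ler_nat.
exact: bin_ratio.
Qed.

Lemma bin_le_half (m i : nat) : ('C(m, i) <= 'C(m, m./2))%N.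
Proof.
have step j : (j.*2.+1 <= m)%N -> ('C(m, j) <= 'C(m, j.+1))%N.
  move=> jm; rewrite -(leq_pmul2l (ltn0Sn j)) mul_bin_left leq_mul2r.
  by apply/orP; right; lia.
have low j : (j <= m./2)%N -> ('C(m, j) <= 'C(m, m./2))%N.
  move=> jm; have -> : j = (m./2 - (m./2 - j))%N by lia.
  have: (m./2 - j <= m./2)%N by lia.
  elim: (m./2 - j)%N => [|k IHk] km; first by rewrite subn0.
  apply: leq_trans (IHk (ltnW km)).
  have -> : (m./2 - k)%N = (m./2 - k.+1).+1 by lia.
  apply: step; lia.
have [/low//|im] := leqP i m./2.
have [mi|mi] := leqP i m; last by rewrite bin_small.
rewrite -bin_sub//; apply: low; lia.
Qed.

Lemma bin_half_ge (m : nat) : (2 ^ m <= m.+1 * 'C(m, m./2))%N.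
Proof.
rewrite -[2%N]/(1 + 1)%N expnDn -[m.+1 in leqRHS]card_ord -sum_nat_const.
by apply: leq_sum => i _; rewrite !exp1n !muln1 bin_le_half.
Qed.

(** The ratio of consecutive coefficients [c + i] and [c + i + 1] is at least
    [(c - i) / (c + i + 1) >= exp (- (2 i + 1) / (c - i))], where [c = m./2],
    and the first [k] odd numbers add up to [k ^ 2].  The common lower bound [D]
    of the denominators keeps the exponent in closed form. *)
Lemma bin_tail_ge (R : realType) (m k D : nat) :
  (0 < D)%N -> (D + k <= m./2.+1)%N ->
  expR (- (k%:R ^+ 2 / D%:R)) * 'C(m, m./2)%:R <= 'C(m, m./2 + k)%:R :> R.
Proof.
move=> D0; set c := m./2.
have D0R : 0 < D%:R :> R by rewrite ltr0n.
elim: k => [|k IHk] Dk.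
  by rewrite expr0n mul0r oppr0 expR0 mul1r addn0.
have {}IHk := IHk (leq_trans (leq_add (leqnn D) (leqnSn k)) Dk).
have ck : (D <= c - k)%N by lia.
have ckR : 0 < (c - k)%:R :> R by rewrite ltr0n; lia.
have bin : 'C(m, c + k.+1)%:R * (c + k).+1%:R = 'C(m, c + k)%:R * (m - (c + k))%:R :> R.
  by rewrite -!natrM addnS mulnC mul_bin_left mulnC.
have ckS : 0 < (c + k).+1%:R :> R by rewrite ltr0n.
rewrite -(ler_pM2r ckS) bin.
apply: (@le_trans _ _ ('C(m, c + k)%:R * (c - k)%:R)); last first.
  by rewrite ler_wpM2l// ler_nat /c; lia.
apply: le_trans (ler_wpM2r (ltW ckR) IHk).
rewrite mulrAC [leRHS]mulrAC ler_wpM2r//.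
have -> : - (k.+1%:R ^+ 2 / D%:R) = - (k%:R ^+ 2 / D%:R) - (2 * k%:R + 1) / D%:R :> R.
  by rewrite -natr1; field; rewrite gt_eqF.
rewrite expRD -mulrA ler_wpM2l ?expR_ge0// expRN mulrC ler_pdivrMr ?expR_gt0//.
apply: le_trans (ler_wpM2l (ltW ckR) (expR_ge1Dx _)).
have -> : (c + k).+1%:R = (c - k)%:R + (2 * k%:R + 1) :> R.
  by rewrite -natr1 !natrD natrB; [ring | lia].
rewrite mulrDr mulr1 lerD2l mulrA ler_pdivlMr// mulrC ler_wpM2r// ?ler_nat//.
Qed.

(** Choosing [j] ones inside [A] and arbitrary values outside [A] is an injective
    way to produce points of the event. *)
Lemma avg_ones_ge (R : realType) (I : finType) (A : {set I}) (j : nat) :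
  'C(#|A|, j)%:R / 2 ^+ #|A| <= avg (fun z => (j <= ones A z)%:R) :> R.
Proof.
rewrite /avg -natr_sum -big_mkcond/= sum1_card.
have Icard : (#|I| = #|A| + #|~: A|)%N by rewrite cardsC.
rewrite ler_pdivlMr ?exprn_gt0// Icard exprD mulrA.
rewrite divfK ?expf_neq0//.
rewrite -natrX -natrM ler_nat -cards_draws -card_powerset -cardsX.
pose h (p : {set I} * {set I}) : {ffun I -> bool} := [ffun i => (i \in p.1) || (i \in p.2)].
set X := finset.setX _ _.
have injh : {in X &, injective h}.
  move=> [Y W] [Y' W']; rewrite !inE /= => /andP[/andP[YA _] WA] /andP[/andP[YA' _] WA'] /ffunP hh.
  congr pair; apply/setP => i; have := hh i; rewrite !ffunE/=.
    have [iA|iA] := boolP (i \in A).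
      have /negbTE -> : i \notin W by apply/negP => /(fintype.subsetP WA); rewrite inE iA.
      have /negbTE -> : i \notin W' by apply/negP => /(fintype.subsetP WA'); rewrite inE iA.
      by rewrite !orbF.
    have /negbTE -> : i \notin Y by apply: contra iA => /(fintype.subsetP YA).
    by have /negbTE -> : i \notin Y' by apply: contra iA => /(fintype.subsetP YA').
  have [iA|iA] := boolP (i \in A).
    have /negbTE -> : i \notin W by apply/negP => /(fintype.subsetP WA); rewrite inE iA.
    by have /negbTE -> : i \notin W' by apply/negP => /(fintype.subsetP WA'); rewrite inE iA.
  have /negbTE -> : i \notin Y by apply: contra iA => /(fintype.subsetP YA).
  by have /negbTE -> : i \notin Y' by apply: contra iA => /(fintype.subsetP YA').
rewrite -(card_in_imset injh); apply: subset_leq_card; apply/fintype.subsetP => z.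
move=> /imsetP[[Y W]]; rewrite !inE/= => /andP[/andP[YA /eqP Yj] WA] ->.
suff : (j <= ones A (h (Y, W)))%N by [].
rewrite -Yj -sum1_card /ones big_mkcond [leqRHS]big_mkcond/=.
apply: leq_sum => i _; rewrite ffunE/=.
by have [iY|//] := boolP (i \in Y); rewrite (fintype.subsetP YA).
Qed.

(** * Second moment of the number of dense sets *)

Lemma natr_bin2 (R : comPzRingType) (n : nat) :
  2 * 'C(n, 2)%:R = n%:R * (n%:R - 1) :> R.
Proof.
elim: n => [|n IHn]; first by rewrite mulr0 mul0r.
by rewrite binS bin1 natrD mulrDr IHn -natr1; ring.
Qed.

(** With [x = o / K] this is [2 x^2 / (1 + x^2) <= x], that is
    [0 <= (K - o)^2], up to lower order terms of the right sign. *)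
Lemma overlap_exponent (R : realFieldType) (K o : nat) : (o <= K)%N ->
  2 * K%:R * 'C(o, 2)%:R <= o%:R * ('C(K, 2) + 'C(o, 2))%:R :> R.
Proof.
move=> oK; rewrite natrD; have := natr_bin2 R o; have := natr_bin2 R K.
set x := 'C(o, 2)%:R; set y := 'C(K, 2)%:R => yE xE.
have Ko : 0 <= K%:R - o%:R :> R by rewrite subr_ge0 ler_nat.
rewrite -(ler_pM2l (ltr0n R 2)) -subr_ge0.
have -> : 2 * (o%:R * (y + x)) - 2 * (2 * K%:R * x)
  = o%:R * ((K%:R - o%:R) ^+ 2 + (K%:R - o%:R)) :> R.
  have -> : 2 * (o%:R * (y + x)) = o%:R * (2 * y + 2 * x) by ring.
  have -> : 2 * (2 * K%:R * x) = 2 * K%:R * (2 * x) by ring.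
  by rewrite yE xE; ring.
by rewrite mulr_ge0// addr_ge0// sqr_ge0.
Qed.

(** The second moment method for the number of sets with at least [m./2 + k]
    edges, [k] being at most the first moment threshold.  The first two terms of
    the exponent come from the lower bound on the probability that one set
    reaches the level and from the upper bound for two sets; they nearly cancel
    when [2 * D] is close to [m]. *)
Lemma Psi_lower_prob (R : realType) (n K k D : nat) :
  let m := 'C(K, 2) in
  (1 < K)%N -> (K <= n)%N -> (0 < k)%N -> (0 < D)%N -> (D + k <= m./2.+1)%N ->
  2 * k%:R ^+ 2 <= m%:R * K%:R * ln (n%:R / K%:R) :> R ->
  expR (- (2 * k%:R ^+ 2 / D%:R - 4 * k%:R ^+ 2 / m%:R + 4 * k%:R / m%:R))
    / (2 ^+ K * m.+1%:R ^+ 2)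
  <= avg (fun z : {ffun edge n -> bool} => (m./2 + k <= Psi K z)%N%:R) :> R.
Proof.
move=> m K1 Kn k0 D0 Dk kL.
set c := m./2.
have m0 : (0 < m)%N by rewrite bin_gt0.
have m0R : 0 < m%:R :> R by rewrite ltr0n.
have K0 : (0 < K)%N by apply: ltn_trans K1.
have K0R : 0 < K%:R :> R by rewrite ltr0n.
have n0R : 0 < n%:R :> R by rewrite ltr0n (leq_trans K0).
have k0R : 1 <= k%:R :> R by rewrite ler1n.
set L := ln _ in kL.
have L0 : 0 <= L by rewrite ln_ge0// ler_pdivlMr// mul1r ler_nat.
pose Q := [pred S : {set 'I_n} | #|S| == K].
pose E (S : {set 'I_n}) (z : {ffun edge n -> bool}) := (c + k <= ones (inner S) z)%N.
pose C : R := 'C(n, K)%:R.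
have C0 : 0 < C by rewrite /C ltr0n bin_gt0.
have cardQ : \sum_(S | Q S) (1 : R) = C.
  rewrite (eq_bigl [in [set S : {set 'I_n} | #|S| == K]%SET]).
    by rewrite sumr_const card_draws card_ord.
  by move=> S; rewrite !inE.
pose pl : R := expR (- (k%:R ^+ 2 / D%:R)) / m.+1%:R.
have pl0 : 0 < pl by rewrite /pl divr_gt0 ?expR_gt0.
have one S : Q S -> pl <= avg (fun z => (E S z)%:R).
  move=> /eqP SK; apply: le_trans (avg_ones_ge _ _ _).
  rewrite card_inner SK -/m; have := bin_tail_ge R D0 Dk.
  rewrite -/c => h.
  rewrite ler_pdivlMr ?exprn_gt0//; apply: le_trans h.
  rewrite /pl -mulrA ler_wpM2l ?expR_ge0// mulrC ler_pdivrMr// mulrC -natrX -natrM.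
  by rewrite ler_nat bin_half_ge.
set err := (X in expR (- X)).
have two S S' : Q S -> Q S' -> avg (fun z => (E S z && E S' z)%:R) <=
    pl ^+ 2 * m.+1%:R ^+ 2 * expR err * (n%:R / K%:R) ^+ #|S :&: S'|.
  move=> /eqP SK /eqP SK'; set o := #|_ :&: _|.
  have oK : (o <= K)%N by rewrite -SK subset_leq_card// finset.subsetIl.
  (* Half a unit is lost when [m] is odd and [m./2] is rounded down. *)
  pose t : R := k%:R - 1 / 2.
  have t0 : 0 <= t by rewrite /t; lra.
  have := @avg_two_tails R _ (inner S) (inner S') m t.
  rewrite !card_inner innerI card_inner SK SK' -/o => /(_ erefl erefl m0 t0).
  set q := 'C(o, 2) => h.
  apply: le_trans (_ : _ <= expR (- (4 * t ^+ 2 / (m + q)%:R))) _.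
    apply: le_trans h; apply: le_avg => z; rewrite ler_nat.
    have Et A : (c + k <= ones A z)%N -> m%:R / 2 + t <= (ones A z)%:R :> R.
      rewrite -(ler_nat R); apply: le_trans.
      have : (m <= c * 2 + 1)%N.
        by rewrite /c muln2 -[leqLHS]odd_double_half addnC leq_add2l leq_b1.
      rewrite -(ler_nat R) !natrD natrM /t; lra.
    rewrite /E; case: (boolP (_ && _)) => // /andP[/Et -> /Et ->] //.
  have mq0 : 0 < (m + q)%:R :> R by rewrite ltr0n addn_gt0 m0.
  have -> : pl ^+ 2 * m.+1%:R ^+ 2 = expR (- (2 * k%:R ^+ 2 / D%:R)).
    rewrite -exprMn divfK ?pnatr_eq0// -expRM_natl; congr expR; ring.
  have -> : n%:R / K%:R = expR L :> R.
    by rewrite lnK// posrE divr_gt0.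
  rewrite -expRM_natl -!expRD ler_expR /err.
  have qo : 2 * k%:R ^+ 2 * (2 * q%:R) <= m%:R * L * (o%:R * (m + q)%:R).
    apply: le_trans (_ : (m%:R * K%:R * L) * (2 * q%:R) <= _).
      by rewrite ler_wpM2r// mulr_ge0.
    have := overlap_exponent R oK; rewrite -/q -/m => ov.
    have mL : 0 <= m%:R * L by rewrite mulr_ge0.
    have := ler_wpM2l mL ov; lra.
  have q1 : 4 * k%:R ^+ 2 / m%:R - 4 * k%:R ^+ 2 / (m + q)%:R <= o%:R * L.
    have -> : 4 * k%:R ^+ 2 / m%:R - 4 * k%:R ^+ 2 / (m + q)%:R
        = (2 * k%:R ^+ 2 * (2 * q%:R)) / (m%:R * (m + q)%:R) :> R.
      have := mq0; rewrite natrD => mq0'; field; by rewrite !gt_eqF.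
    by rewrite ler_pdivrMr ?mulr_gt0//; lra.
  have q2 : 4 * k%:R ^+ 2 / (m + q)%:R - 4 * k%:R / m%:R <= 4 * t ^+ 2 / (m + q)%:R.
    apply: (@le_trans _ _ (4 * k%:R ^+ 2 / (m + q)%:R - 4 * k%:R / (m + q)%:R)).
      rewrite lerB// ler_wpM2l ?mulr_ge0// lef_pV2 ?posrE// ler_nat leq_addr//.
    by rewrite -mulrBl ler_wpM2r ?invr_ge0 ?(ltW mq0)// /t; lra.
  lra.
pose N (z : {ffun edge n -> bool}) : R := \sum_(S | Q S) (E S z)%:R.
have EN : C * pl <= avg N.
  rewrite /N avg_sum -cardQ mulr_suml; apply: ler_sum => S QS.
  by rewrite mul1r one.
have ENN : \sum_(S | Q S) \sum_(S' | Q S') avg (fun z => (E S z && E S' z)%:R)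
    <= C ^+ 2 * (pl ^+ 2 * m.+1%:R ^+ 2 * expR err * 2 ^+ K).
  set b := pl ^+ 2 * m.+1%:R ^+ 2 * expR err.
  have b0 : 0 <= b by rewrite /b !mulr_ge0 ?expR_ge0 ?exprn_ge0// ltW.
  apply: le_trans (_ : \sum_(S | Q S) 1 * (b * (2 ^+ K * C)) <= _); last first.
    by rewrite -mulr_suml cardQ; rewrite le_eqVlt; apply/orP; left; apply/eqP; ring.
  apply: ler_sum => S QS; rewrite mul1r.
  apply: le_trans (_ : \sum_(S' | Q S') b * (n%:R / K%:R) ^+ #|S :&: S'| <= _).
    by apply: ler_sum => S' QS'; apply: two.
  rewrite -mulr_sumr ler_wpM2l// sum_overlap//; exact/eqP.
have EN0 : 0 < avg N by apply: lt_le_trans EN; rewrite mulr_gt0.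
have := second_moment EN0.
set U := avg (fun z => [exists j, Q j && E j z]%:R).
have UP : U <= avg (fun z : {ffun edge n -> bool} => (c + k <= Psi K z)%N%:R).
  apply: le_avg => z; rewrite ler_nat; case: existsP => // -[S /andP[QS ES]].
  rewrite lt0b; apply: leq_trans ES _; rewrite -edge_countE.
  exact: (@leq_bigmax_cond _ Q (fun S => edge_count z S)).
have U0 : 0 <= U by apply: avg_ge0.
move=> sm; apply: le_trans UP.
have : (C * pl) ^+ 2 <= U * (C ^+ 2 * (pl ^+ 2 * m.+1%:R ^+ 2 * expR err * 2 ^+ K)).
  apply: le_trans (_ : avg N ^+ 2 <= _).
    by rewrite lerXn2r// nnegrE ltW// mulr_gt0.
  by apply: le_trans sm _; rewrite ler_wpM2l.
have -> : U * (C ^+ 2 * (pl ^+ 2 * m.+1%:R ^+ 2 * expR err * 2 ^+ K))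
   = (C * pl) ^+ 2 * (U * (2 ^+ K * m.+1%:R ^+ 2) * expR err) by ring.
rewrite -[X in X <= _ -> _]mulr1 ler_pM2l ?exprn_gt0 ?mulr_gt0// => h.
rewrite ler_pdivrMr; last by rewrite mulr_gt0 ?exprn_gt0.
by rewrite expRN -[X in X <= _]mul1r ler_pdivrMr ?expR_gt0.
Qed.

(** * Upper tail of the maximum *)

(** The usual bound [(e n / K) ^ K]; [K! >= (K / e) ^ K] is one term of the
    exponential series at [K]. *)
Lemma bin_le_expR (R : realType) (n K : nat) : (0 < K)%N -> (K <= n)%N ->
  'C(n, K)%:R <= expR (K%:R * (ln (n%:R / K%:R) + 1)) :> R.
Proof.
move=> K0 Kn.
have K0R : 0 < K%:R :> R by rewrite ltr0n.
have n0R : 0 < n%:R :> R by rewrite ltr0n (leq_trans K0).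
have ffact_le : (n ^_ K <= n ^ K)%N.
  elim: (X in (_ ^_ X <= _ ^ X)%N) => [//|i IHi].
  by rewrite ffactnSr expnSr leq_mul// leq_subr.
have KK : K%:R ^+ K <= expR K%:R * K`!%:R :> R.
  have := @expR_ge1Dxn R K%:R K.-1 (ltW K0R); rewrite prednK// => h.
  rewrite -ler_pdivrMr ?ltr0n ?fact_gt0//; apply: le_trans h.
  by rewrite lerDr.
rewrite mulrDr mulr1 expRD expRM_natl lnK ?posrE ?divr_gt0// expr_div_n.
have Kf : 0 < K`!%:R :> R by rewrite ltr0n fact_gt0.
rewrite -(ler_pM2r Kf) -natrM bin_ffact.
rewrite -[leRHS]mulrA [leRHS]mulrAC ler_pdivlMr ?exprn_gt0//.
apply: ler_pM => //; first by rewrite -natrX ler_nat.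
Qed.

Lemma PsiE (n K : nat) (z : {ffun edge n -> bool}) :
  Psi K z = (\max_(S : {set 'I_n} | #|S| == K) ones (inner S) z)%N.
Proof. by apply: eq_bigr => S _; rewrite edge_countE. Qed.

(** In terms of [w = K^(1/2)] and [y = (ln n)^(1/2)], all quantities below are
    polynomials, apart from the square root of [L]. *)
Lemma scales (R : realType) (n K : nat) (w := Num.sqrt K%:R : R)
    (y := Num.sqrt (ln n%:R) : R) (L := ln (n%:R / K%:R) : R) :
  (1 < K)%N -> (K <= n)%N ->
  [/\ 0 < w, w ^+ 2 = K%:R & 2 * 'C(K, 2)%:R = w ^+ 2 * (w ^+ 2 - 1)] /\
  [/\ y ^+ 2 = ln n%:R, 0 <= L, Num.sqrt L ^+ 2 = L & Num.sqrt L <= y].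
Proof.
move=> K1 Kn.
have K0 : (0 < K)%N by apply: ltn_trans K1.
have K0R : 0 < K%:R :> R by rewrite ltr0n.
have n0R : 0 < n%:R :> R by rewrite ltr0n (leq_trans K0).
have L0 : 0 <= L by rewrite ln_ge0// ler_pdivlMr// mul1r ler_nat.
have l0 : 0 <= ln n%:R :> R by rewrite ln_ge0// ler1n (leq_trans K0).
have w2 : w ^+ 2 = K%:R by rewrite sqr_sqrtr ?ltW.
split; split => //; first by rewrite sqrtr_gt0.
- by rewrite natr_bin2 w2.
- by rewrite sqr_sqrtr.
- by rewrite sqr_sqrtr.
rewrite ler_wsqrtr// ler_ln ?posrE ?divr_gt0// ler_pdivrMr// ler_peMr ?ler1n//.
Qed.

Lemma Psi_upper (R : realType) (n K : nat) (eps : R)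
    (w := Num.sqrt K%:R : R) (y := Num.sqrt (ln n%:R) : R)
    (L := ln (n%:R / K%:R) : R) :
  (1 < K)%N -> (K <= n)%N -> 0 < eps ->
  1 <= 2 * eps ^+ 2 * ln n%:R -> 1 <= 2 * eps ^+ 2 * K%:R ->
  avg (fun z : {ffun edge n -> bool} =>
    (w ^+ 4 / 4 + w ^+ 3 * Num.sqrt L / 2 + eps * (w ^+ 3 * y) < (Psi K z)%:R :> R)%:R)
  <= expR (- ln n%:R) :> R.
Proof.
move=> K1 Kn eps0 hl hK.
have [[w0 w2 mE] [y2 L0 sL sLy]] := scales R K1 Kn.
rewrite -/w -/y -/L in w0 w2 mE y2 L0 sL sLy *.
set m := 'C(K, 2) in mE.
set l := ln n%:R in y2 hl *.
have m0 : (0 < m)%N by rewrite bin_gt0.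
have m0R : 0 < m%:R :> R by rewrite ltr0n.
have K0 : (0 < K)%N by apply: ltn_trans K1.
have K0R : 0 < K%:R :> R by rewrite ltr0n.
have w22 : 2 <= w ^+ 2 by rewrite w2 (ler_nat R 2).
have y0 : 0 <= y by apply: sqrtr_ge0.
have l0 : 0 <= l by rewrite -y2 sqr_ge0.
have sL0 : 0 <= Num.sqrt L by apply: sqrtr_ge0.
have ly : 0 < y.
  rewrite lt0r y0 andbT; apply/eqP => yy; move: hl; rewrite -y2 yy expr0n mulr0.
  by rewrite ler10.
pose t : R := w ^+ 3 * (Num.sqrt L / 2 + eps * y).
have t0 : 0 < t.
  rewrite /t mulr_gt0 ?exprn_gt0// ltr_wpDl ?divr_ge0// mulr_gt0//.
have card_m (S : {set 'I_n}) : #|S| == K -> #|inner S| = m by move=> /eqP SK; rewrite card_inner SK.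
have := max_upper_tail (Q := [pred S : {set 'I_n} | #|S| == K]) card_m m0 t0.
have -> : #|[pred S : {set 'I_n} | #|S| == K]| = 'C(n, K).
  rewrite -[n in RHS]card_ord -card_draws; apply: eq_card => S; by rewrite !inE.
move=> h; apply: le_trans (_ : _ <= 'C(n, K)%:R * expR (- (2 * t ^+ 2 / m%:R))) _.
  apply: le_trans h; apply: le_avg => z.
  rewrite PsiE.
  set X := (\max_(_ | _) _)%N; rewrite ler_nat.
  case: ltP => // /ltW hX; rewrite lt0b; apply: le_trans hX.
  have : m%:R / 2 <= w ^+ 4 / 4.
    have -> : w ^+ 4 = 2 * m%:R + w ^+ 2 by rewrite mE; ring.
    have := sqr_ge0 w; lra.
  rewrite /t; lra.
apply: le_trans (ler_wpM2r (expR_ge0 _) (bin_le_expR R K0 Kn)) _.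
rewrite -expRD ler_expR -/L.
have tE : K%:R * (L + 4 * eps ^+ 2 * l) <= 2 * t ^+ 2 / m%:R.
  rewrite ler_pdivlMr//.
  have -> : t ^+ 2 = K%:R ^+ 3 * (Num.sqrt L / 2 + eps * y) ^+ 2 by rewrite -w2 /t; ring.
  have -> : 2 * (K%:R ^+ 3 * (Num.sqrt L / 2 + eps * y) ^+ 2)
     = K%:R * (4 * (Num.sqrt L / 2 + eps * y) ^+ 2) * (K%:R ^+ 2 / 2) by field.
  apply: ler_pM => //.
  - rewrite mulr_ge0 ?(ltW K0R)//; apply: addr_ge0 => //.
    by do !apply: mulr_ge0 => //; exact: ltW.
  - rewrite ler_wpM2l ?(ltW K0R)//.
    have -> : 4 * (Num.sqrt L / 2 + eps * y) ^+ 2 = Num.sqrt L ^+ 2 + 4 * eps ^+ 2 * y ^+ 2 + 4 * (Num.sqrt L * eps * y) by field.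
    by rewrite sL y2 lerDl !mulr_ge0// ltW.
  - have := mE; rewrite -w2; have := sqr_ge0 w; set u := w ^+ 2; nra.
have : l <= K%:R * (2 * eps ^+ 2 * l).
  by rewrite mulrA ler_peMl//; lra.
have : K%:R * 1 <= K%:R * (2 * eps ^+ 2 * l) by rewrite ler_wpM2l// ltW.
lra.
Qed.

(** * Lower tail of the maximum *)

(** The left-hand side is the asymptotic form of the first moment threshold on
    the right, [sqrt (w^2 - 1)] being at least [w - 1]. *)
Lemma sqrt_gap (R : realType) (w L : R) : 1 <= w ->
  w ^+ 3 * Num.sqrt L / 2 - w ^+ 2 * Num.sqrt L / 2 <=
  Num.sqrt (w ^+ 4 * (w ^+ 2 - 1) * L / 4).
Proof.
move=> w1; have [L0|/ltW L0] := leP 0 L; last first.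
  by rewrite (ler0_sqrtr L0) !mulr0 !mul0r subrr sqrtr_ge0.
have -> : w ^+ 3 * Num.sqrt L / 2 - w ^+ 2 * Num.sqrt L / 2
          = Num.sqrt ((w ^+ 2 * (w - 1) / 2) ^+ 2 * L).
  rewrite sqrtrM ?sqr_ge0// sqrtr_sqr ger0_norm; first ring.
  by rewrite divr_ge0// mulr_ge0 ?sqr_ge0// subr_ge0.
rewrite ler_sqrt; last first.
  by rewrite divr_ge0// mulr_ge0// mulr_ge0 ?exprn_ge0//; nra.
have : 0 <= w ^+ 4 * L * (w - 1) by rewrite !mulr_ge0 ?exprn_ge0// ?subr_ge0//; lra.
nra.
Qed.

(** The small parameter [eta] stands for both limits used in the sequel, [ln n]
    to infinity and [ln n / K] to 0. *)
Lemma scale_sizes (R : realType) (n K : nat) (eta : R)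
    (w := Num.sqrt K%:R : R) (y := Num.sqrt (ln n%:R) : R) :
  (1 < K)%N -> (K <= n)%N -> 0 < eta -> eta <= 1 / 8 ->
  y <= eta * w -> 1 <= eta * ln n%:R ->
  [/\ 1 <= y, 8 <= w & 1 <= eta * K%:R].
Proof.
move=> K1 Kn eta0 eta8 yw letal.
have [[w0 w2 _] [y2 _ _ _]] := scales R K1 Kn.
rewrite -/w -/y in w0 w2 y2.
have y1 : 1 <= y.
  have l0 : 0 <= ln n%:R :> R by rewrite -y2 sqr_ge0.
  have : 1 <= y ^+ 2.
    rewrite y2; apply: le_trans letal _; rewrite ler_piMl//; lra.
  by rewrite expr_ge1// sqrtr_ge0.
have w8 : 8 <= w.
  have : 8 * (eta * w) <= w by rewrite mulrA ler_piMl ?(ltW w0)//; lra.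
  lra.
split=> //.
rewrite -w2 expr2 mulrA; apply: le_trans (_ : 1 * w <= _); first lra.
by rewrite ler_wpM2r ?(ltW w0)//; lra.
Qed.

(** The two terms cancel when [2 * D = M]; the hypotheses allow [2 * D] to fall
    short of [M] by [2 * k], which costs a term of the next order in [k / M]. *)
Lemma second_moment_error (R : realFieldType) (k M D : R) :
  0 <= k -> 0 < D -> 0 < M -> M - 2 * k <= 2 * D -> 4 * k <= M ->
  2 * k ^+ 2 / D - 4 * k ^+ 2 / M <= 16 * k ^+ 3 / M ^+ 2.
Proof.
move=> k0 D0 M0 MD k4.
have : 1 / D <= (2 * M + 8 * k) / M ^+ 2.
  rewrite ler_pdivlMr ?exprn_gt0// mulrAC ler_pdivrMr// mul1r.
  have : M ^+ 2 <= (M - 2 * k) / 2 * (2 * M + 8 * k).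
    have : 0 <= 2 * k * (M - 4 * k) by rewrite !mulr_ge0// subr_ge0.
    lra.
  move=> /le_trans; apply; rewrite mulrC ler_wpM2l; lra.
have k2 : 0 <= 2 * k ^+ 2 by rewrite mulr_ge0// sqr_ge0.
move=> /(ler_wpM2l k2).
have -> : 2 * k ^+ 2 * ((2 * M + 8 * k) / M ^+ 2)
  = 4 * k ^+ 2 / M + 16 * k ^+ 3 / M ^+ 2 by field; rewrite gt_eqF.
lra.
Qed.

(** Here [k] is the first moment threshold [t] rounded down.  As [k] is of order
    [w ^+ 3 * y] and [m] of order [w ^+ 4], every loss, including [2 ^ K] and
    the error term [k ^+ 3 / m ^+ 2 = O (w * y ^+ 3)], is a small multiple of
    [K%:R * ln n%:R = w ^+ 2 * y ^+ 2]: 32 for the error term, 1 each for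
    [4 * k / m] and [2 ^ K], and 4 for [m.+1 ^ 2 <= n ^ 4] make up the factor
    38.  The term [9 / 4 * (w ^+ 2 * y)] covers the lower order terms of [m] and
    of the threshold, and the rounding. *)
Lemma Psi_reaches_level (R : realType) (n K : nat) (eta : R)
    (w := Num.sqrt K%:R : R) (y := Num.sqrt (ln n%:R) : R)
    (L := ln (n%:R / K%:R) : R) :
  (1 < K)%N -> (K <= n)%N -> 0 < eta -> eta <= 1 / 8 ->
  y <= eta * w -> 1 <= eta * ln n%:R -> 1 <= L ->
  exists2 tau : nat,
    w ^+ 4 / 4 + w ^+ 3 * Num.sqrt L / 2 - 9 / 4 * (w ^+ 2 * y) <= tau%:R &
    expR (- (38 * (eta * (K%:R * ln n%:R)))) <=
    avg (fun z : {ffun edge n -> bool} => (tau <= Psi K z)%N%:R) :> R.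
Proof.
move=> K1 Kn eta0 eta8 yw letal L1.
have [y1 w8 etaK] := scale_sizes K1 Kn eta0 eta8 yw letal.
rewrite -/w -/y in y1 w8.
have [[w0 w2 mE] [y2 L0 sL sLy]] := scales R K1 Kn.
rewrite -/w -/y -/L in w0 w2 mE y2 L0 sL sLy *.
set m := 'C(K, 2) in mE.
set l := ln n%:R in y2 letal *.
have m0 : (0 < m)%N by rewrite bin_gt0.
have m0R : 0 < m%:R :> R by rewrite ltr0n.
have K0 : (0 < K)%N by apply: ltn_trans K1.
have K0R : 0 < K%:R :> R by rewrite ltr0n.
have w22 : 2 <= w ^+ 2 by rewrite w2 (ler_nat R 2).
have y0 : 0 <= y by apply: sqrtr_ge0.
have l0 : 0 <= l by rewrite -y2 sqr_ge0.
pose t := Num.sqrt (m%:R * K%:R * L / 2).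
have tK : t = Num.sqrt (w ^+ 4 * (w ^+ 2 - 1) * L / 4).
  congr Num.sqrt; rewrite -w2.
  have -> : w ^+ 4 * (w ^+ 2 - 1) * L / 4 = w ^+ 2 * (w ^+ 2 * (w ^+ 2 - 1)) * L / 4 by ring.
  by rewrite -mE; field.
have w1 : 1 <= w by lra.
have w40 : 0 < w ^+ 4 by rewrite exprn_gt0.
have w61 : 0 <= w ^+ 2 - 1 by lra.
have argt0 : 0 <= w ^+ 4 * (w ^+ 2 - 1) * L / 4 by rewrite !mulr_ge0// ltW.
have t0 : 0 <= t by rewrite sqrtr_ge0.
have t2 : t ^+ 2 = w ^+ 4 * (w ^+ 2 - 1) * L / 4 by rewrite tK sqr_sqrtr.
pose k := Num.truncn t.
have /andP[kt tk] := truncn_itv t0.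
rewrite -/k -natr1 in kt tk.
have tub : t <= w ^+ 3 * y / 2.
  rewrite -(@ler_pXn2r _ 2) ?nnegrE ?divr_ge0 ?mulr_ge0 ?exprn_ge0 ?(ltW w0)//.
  rewrite t2.
  have -> : (w ^+ 3 * y / 2) ^+ 2 = w ^+ 4 * (w ^+ 2 * y ^+ 2) / 4 by field.
  rewrite ler_wpM2r ?invr_ge0// -mulrA ler_wpM2l ?(ltW w40)//.
  by rewrite -sL; apply: ler_pM; rewrite ?sqr_ge0// ?lerXn2r// ?nnegrE//; lra.
have k1 : (0 < k)%N.
  rewrite truncn_gt0 -(@ler_pXn2r _ 2) ?nnegrE// expr1n t2.
  have w44 : 4 <= w ^+ 4.
    have -> : w ^+ 4 = w ^+ 2 * w ^+ 2 by ring.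
    by have := ler_pM (ler0n R 2) (ler0n R 2) w22 w22; lra.
  have h1 : 1 <= (w ^+ 2 - 1) * L.
    by rewrite -[1 in leLHS]mulr1; apply: ler_pM => //; lra.
  have := ler_pM (ler0n R 4) ler01 w44 h1; lra.
set c := m./2.
have cm : m%:R - 1 <= 2 * c%:R :> R.
  have : (m <= c * 2 + 1)%N by rewrite /c muln2 -[leqLHS]odd_double_half addnC leq_add2l leq_b1.
  by rewrite -(ler_nat R) natrD natrM; lra.
have w3y : w ^+ 3 * y <= eta * w ^+ 4.
  have -> : eta * w ^+ 4 = w ^+ 3 * (eta * w) by ring.
  by rewrite ler_wpM2l// exprn_ge0// ltW.
have mw : w ^+ 4 / 4 <= m%:R.
  have : w ^+ 2 * w ^+ 2 / 2 <= 2 * m%:R by rewrite mE -mulrA ler_wpM2l//; lra.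
  have -> : w ^+ 4 = w ^+ 2 * w ^+ 2 by ring.
  lra.
have k4 : 4 * k%:R <= m%:R :> R.
  have : eta * w ^+ 4 <= 1 / 8 * w ^+ 4 by rewrite ler_wpM2r// ltW.
  lra.
have m8 : 16 <= m%:R :> R.
  have : 8 ^+ 4 <= w ^+ 4 by rewrite lerXn2r ?nnegrE ?(ltW w0).
  lra.
have kc : (k <= c)%N by rewrite -(ler_nat R); lra.
pose D := (c - k + 1)%N.
have D0 : (0 < D)%N by rewrite /D addn1.
have DR : D%:R = c%:R - k%:R + 1 :> R by rewrite /D natrD natrB.
have Dk : (D + k <= c.+1)%N by rewrite /D addnAC subnK// addn1.
have kL : 2 * k%:R ^+ 2 <= m%:R * K%:R * L :> R.
  have : k%:R ^+ 2 <= t ^+ 2 by rewrite lerXn2r// nnegrE.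
  have : m%:R * K%:R * L = 2 * t ^+ 2.
    rewrite /t sqr_sqrtr; first by field.
    by rewrite !mulr_ge0// ltW.
  lra.
have lowp := Psi_lower_prob K1 Kn k1 D0 Dk kL.
exists (c + k)%N.
  have tlow := sqrt_gap L w1; rewrite -tK in tlow.
  have h2 : w ^+ 2 <= w ^+ 2 * y by rewrite ler_peMr// sqr_ge0.
  have h3 : w ^+ 2 * Num.sqrt L <= w ^+ 2 * y by rewrite ler_wpM2l// sqr_ge0.
  have h4 : w ^+ 2 * w ^+ 2 = 2 * m%:R + w ^+ 2 by rewrite mE; ring.
  have h5 : w ^+ 4 = w ^+ 2 * w ^+ 2 by ring.
  rewrite natrD h5 h4; lra.
set M : R := m%:R in m0R mE cm mw k4 m8 kL lowp *.
set kk : R := k%:R in kt tk k4 DR kL lowp *.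
set KK : R := K%:R in w2 K0R etaK kL lowp *.
have kk0 : 0 <= kk by [].
have DR0 : 0 < D%:R :> R by rewrite ltr0n.
have err_le : 2 * kk ^+ 2 / D%:R - 4 * kk ^+ 2 / M <= 16 * kk ^+ 3 / M ^+ 2.
  apply: second_moment_error => //; lra.
have Kl0 : 0 <= KK * l by rewrite -w2 -y2 mulr_ge0 ?sqr_ge0.
have cube_le : 16 * kk ^+ 3 / M ^+ 2 <= 32 * (eta * (KK * l)).
  rewrite ler_pdivrMr ?exprn_gt0//.
  have h1 : kk ^+ 3 <= (w ^+ 3 * y / 2) ^+ 3.
    rewrite lerXn2r ?nnegrE//; last exact: le_trans kt tub.
    by rewrite divr_ge0// mulr_ge0// exprn_ge0// ltW.
  have h2 : (w ^+ 4 / 4) ^+ 2 <= M ^+ 2.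
    by rewrite lerXn2r ?nnegrE// ?divr_ge0// ltW.
  have h3 : 0 <= w ^+ 9 * y ^+ 2 by rewrite mulr_ge0 ?sqr_ge0// exprn_ge0// ltW.
  have h4 := ler_wpM2l h3 yw.
  have h5 : 0 <= 32 * (eta * (KK * l)) by rewrite !mulr_ge0// ltW.
  have h6 := ler_wpM2l h5 h2.
  apply: le_trans h6; apply: le_trans (ler_wpM2l (ler0n R 16) h1) _.
  rewrite -w2 -y2.
  have -> : 16 * (w ^+ 3 * y / 2) ^+ 3 = 2 * (w ^+ 9 * y ^+ 2 * y) by field.
  have -> : 32 * (eta * (w ^+ 2 * y ^+ 2)) * (w ^+ 4 / 4) ^+ 2
     = 2 * (w ^+ 9 * y ^+ 2 * (eta * w)) by field.
  lra.
have l_le : l <= eta * (KK * l) by rewrite mulrA ler_peMl.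
have K_le : KK <= eta * (KK * l) by rewrite mulrCA ler_peMr// ltW.
have K1R : 1 <= KK by rewrite /KK ler1n.
have n0R : 0 < n%:R :> R by rewrite ltr0n (leq_trans K0).
apply: le_trans lowp; rewrite ler_pdivlMr; last by rewrite mulr_gt0 ?exprn_gt0.
have e2 : 2 ^+ K <= expR KK :> R.
  rewrite -[KK]mulr1 /KK expRM_natl lerXn2r ?nnegrE ?expR_ge0//.
  by apply: le_trans (expR_ge1Dx 1); lra.
have m2 : m.+1%:R ^+ 2 <= expR (4 * l) :> R.
  rewrite -[4 * l]/(4%:R * l) expRM_natl lnK ?posrE//.
  have -> : n%:R ^+ 4 = (n%:R ^+ 2) ^+ 2 :> R by ring.
  rewrite lerXn2r ?nnegrE// ?exprn_ge0//.
  apply: le_trans (_ : KK ^+ 2 <= _); last by rewrite lerXn2r ?nnegrE ?ler_nat// ltW.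
  rewrite -natr1 -w2 -/M.
  have : w ^+ 2 * w ^+ 2 = 2 * M + w ^+ 2 by rewrite mE; ring.
  rewrite -expr2; lra.
apply: le_trans (ler_wpM2l (expR_ge0 _) (ler_pM _ _ e2 m2)) _; rewrite ?exprn_ge0//.
rewrite -!expRD ler_expR.
have : 4 * kk / M <= 1 by rewrite ler_pdivrMr// mul1r.
lra.
Qed.

(** [max_concentration] between the target level and the level of
    [Psi_reaches_level], which lie at least [eps / 2 * K^(3/2) * sqrt (ln n)]
    apart, has the exponent [- eps^2 / 8 * K * ln n].  As [312 = 8 * 39], this
    outweighs the factor 38 of [Psi_reaches_level] and leaves
    [- eta * K * ln n <= - ln n]. *)
Lemma Psi_lower (R : realType) (n K : nat) (eps eta : R)
    (w := Num.sqrt K%:R : R) (y := Num.sqrt (ln n%:R) : R)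
    (L := ln (n%:R / K%:R) : R) :
  (1 < K)%N -> (K <= n)%N -> 0 < eps ->
  0 < eta -> eta <= 1 / 8 -> 5 * eta <= eps -> 312 * eta <= eps ^+ 2 -> eta * eps <= 1 ->
  y <= eta * w -> 1 <= eta * ln n%:R -> 1 <= L ->
  avg (fun z : {ffun edge n -> bool} =>
    ((Psi K z)%:R <= w ^+ 4 / 4 + w ^+ 3 * Num.sqrt L / 2 - eps * (w ^+ 3 * y) :> R)%:R)
  <= expR (- ln n%:R) :> R.
Proof.
move=> K1 Kn eps0 eta0 eta8 eta5 etaeps etaeps1 yw letal L1.
have [y1 w8 etaK] := scale_sizes K1 Kn eta0 eta8 yw letal.
have [tau tau_ge plow] := Psi_reaches_level K1 Kn eta0 eta8 yw letal L1.
rewrite -/w -/y -/L in y1 w8 tau_ge.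
have [[w0 w2 mE] [y2 L0 sL sLy]] := scales R K1 Kn.
rewrite -/w -/y -/L in w0 w2 mE y2 L0 sL sLy *.
set m := 'C(K, 2) in mE.
set l := ln n%:R in y2 letal plow *.
have m0 : (0 < m)%N by rewrite bin_gt0.
have m0R : 0 < m%:R :> R by rewrite ltr0n.
have K0 : (0 < K)%N by apply: ltn_trans K1.
have K0R : 0 < K%:R :> R by rewrite ltr0n.
have y0 : 0 <= y by apply: sqrtr_ge0.
have l0 : 0 <= l by rewrite -y2 sqr_ge0.
set M : R := m%:R in m0R mE.
set KK : R := K%:R in w2 K0R etaK plow *.
have Kl0 : 0 <= KK * l by rewrite mulr_ge0// ltW.
have l_le : l <= eta * (KK * l) by rewrite mulrA ler_peMl.
set p := avg _ in plow.
(* The minimizer of [lam^2 * w^4 / 2 - lam * (eps / 2 * w^3 * y)]. *)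
pose lam := eps * y / (2 * w).
have w20 : 0 < 2 * w by rewrite mulr_gt0.
have lam0 : 0 <= lam by rewrite divr_ge0 ?mulr_ge0// ltW.
have lam1 : lam <= 1 / 2.
  rewrite ler_pdivrMr// ; apply: le_trans (ler_wpM2l (ltW eps0) yw) _.
  have : eta * eps * w <= 1 * w by rewrite ler_wpM2r// ltW.
  lra.
set lo := w ^+ 4 / 4 + w ^+ 3 * Num.sqrt L / 2 - eps * (w ^+ 3 * y).
have card_m (S : {set 'I_n}) : #|S| == K -> (#|inner S| <= m)%N.
  by move=> /eqP SK; rewrite card_inner SK.
have ex_S : exists S : {set 'I_n}, #|S| == K.
  have : (0 < #|[set S : {set 'I_n} | #|S| == K]%SET|)%N.
    by rewrite card_draws card_ord bin_gt0.
  by move=> /card_gt0P[S]; rewrite inE; exists S.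
have := max_concentration lo tau%:R ex_S card_m lam0 lam1.
rewrite -/M.
have -> : (fun z : {ffun edge n -> bool} =>
    (tau%:R <= (\max_(S : {set 'I_n} | #|S| == K) ones (inner S) z)%:R :> R)%:R : R)
  = (fun z => (tau <= Psi K z)%N%:R).
  by apply/funext => z; rewrite -PsiE ler_nat.
rewrite -/p.
have -> : (fun z : {ffun edge n -> bool} =>
    ((\max_(S : {set 'I_n} | #|S| == K) ones (inner S) z)%:R <= lo :> R)%:R : R)
  = (fun z => ((Psi K z)%:R <= lo :> R)%:R).
  by apply/funext => z; rewrite -PsiE.
set A := avg _ => conc.
have gap : eps / 2 * (w ^+ 3 * y) <= tau%:R - lo.
  have epsw : 5 <= eps * w.
    have : 5 * y <= 5 * (eta * w) by rewrite ler_wpM2l.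
    have : 5 * eta * w <= eps * w by rewrite ler_wpM2r// ltW.
    lra.
  have w2y : 0 <= w ^+ 2 * y by rewrite mulr_ge0 ?sqr_ge0.
  have h1 : 5 * (w ^+ 2 * y) <= eps * (w ^+ 3 * y).
    have -> : eps * (w ^+ 3 * y) = eps * w * (w ^+ 2 * y) by ring.
    by rewrite ler_wpM2r.
  rewrite /lo; lra.
have {}conc : A * p <= expR (- (eps ^+ 2 * (KK * l) / 8)).
  apply: le_trans conc _; rewrite ler_expR.
  have h1 := ler_wpM2l lam0 gap.
  have h2 : lam ^+ 2 * M <= lam ^+ 2 * (w ^+ 4 / 2).
    rewrite ler_wpM2l ?sqr_ge0//.
    have -> : w ^+ 4 = w ^+ 2 * w ^+ 2 by ring.
    have -> : w ^+ 2 * w ^+ 2 = 2 * M + w ^+ 2 by rewrite mE; ring.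
    lra.
  have e1 : lam * (eps / 2 * (w ^+ 3 * y)) = eps ^+ 2 * (KK * l) / 4.
    by rewrite /lam -w2 -y2; field; rewrite gt_eqF.
  have e2 : lam ^+ 2 * (w ^+ 4 / 2) = eps ^+ 2 * (KK * l) / 8.
    by rewrite /lam -w2 -y2; field; rewrite gt_eqF.
  lra.
have A0 : 0 <= A by apply: avg_ge0.
have := le_trans (ler_wpM2l A0 plow) conc.
rewrite -ler_pdivlMr ?expR_gt0// -expRB => /le_trans; apply.
rewrite ler_expR.
have := ler_wpM2r Kl0 etaeps; lra.
Qed.

(** * Asymptotics *)

Lemma powR_3half (R : realType) (x : R) : 0 <= x -> x `^ (3 / 2) = Num.sqrt x ^+ 3.
Proof.
move=> x0; rewrite -powR12_sqrt//.
by rewrite -[in RHS]powR_mulrn ?powR_ge0// -powRrM; congr powR; field.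
Qed.

Lemma small_eta (R : realFieldType) (eps : R) : 0 < eps ->
  exists eta : R, [/\ 0 < eta, eta <= 1 / 8, 5 * eta <= eps,
    312 * eta <= eps ^+ 2 & eta * eps <= 1].
Proof.
move=> eps0; have e2 : 0 < eps ^+ 2 by rewrite exprn_gt0.
pose e := Num.min (Num.min (1 / 8) (eps / 5)) (Num.min (eps ^+ 2 / 312) eps^-1).
have h1 : e <= 1 / 8 by rewrite !ge_min lexx.
have h2 : e <= eps / 5 by rewrite !ge_min lexx orbT.
have h3 : e <= eps ^+ 2 / 312 by rewrite !ge_min lexx !orbT.
have h4 : e <= eps^-1 by rewrite !ge_min lexx !orbT.
exists e; split; [|by []|lra|lra|by rewrite -ler_pdivlMr// div1r].
by rewrite !lt_min invr_gt0 eps0 andbT; rewrite -andbA; apply/and3P; split; lra.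
Qed.

(** With [u = n^(alpha / 2)], [ln n] is at most [2 / alpha * u] whereas [K] is at
    least [u^2 - 1]. *)
Lemma subset_size_facts (R : realType) (alpha eta : R) (n : nat)
    (K := subset_size alpha n) (l := ln n%:R : R) :
  0 < alpha -> alpha < 1 -> 0 < eta -> eta <= 1 / 8 ->
  1 / eta <= l -> 4 / (alpha ^+ 2 * eta ^+ 2) <= l -> 1 / (1 - alpha) <= l ->
  [/\ (1 < K)%N, (K <= n)%N, Num.sqrt l <= eta * Num.sqrt K%:R, 1 <= eta * l &
      1 <= ln (n%:R / K%:R) :> R].
Proof.
move=> a0 a1 eta0 eta8 l1 l2 l3.
have etal : 1 <= eta * l by rewrite mulrC -ler_pdivrMr.
have l0 : 0 < l by apply: lt_le_trans l1; rewrite divr_gt0.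
have n0 : 0 < n%:R :> R.
  by rewrite lt0r ler0n andbT; apply/eqP => n00; rewrite /l n00 ln0// ltxx in l0.
have n1 : 1 <= n%:R :> R by rewrite ler1n -(ltr0n R).
pose u := n%:R `^ (alpha / 2) : R.
have u2 : n%:R `^ alpha = u ^+ 2.
  by rewrite /u -powR_mulrn ?powR_ge0// -powRrM; congr powR; field.
have u0 : 0 < u by rewrite powR_gt0.
have lu : l <= 2 / alpha * u.
  have := ln_sublinear u0; rewrite ln_powR -/l => /ltW h.
  have -> : l = 2 / alpha * (alpha / 2 * l) by field; rewrite gt_eqF.
  by rewrite ler_wpM2l// divr_ge0// ltW.
have u_ge : 1 + 2 / (alpha * eta ^+ 2) <= u.
  rewrite /u /powR gt_eqF//; apply: le_trans (expR_ge1Dx _); rewrite lerD2l -/l.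
  have -> : 2 / (alpha * eta ^+ 2) = alpha / 2 * (4 / (alpha ^+ 2 * eta ^+ 2)).
    by field; rewrite !gt_eqF.
  by rewrite ler_wpM2l// divr_ge0// ltW.
have /andP[Ku uK] := truncn_itv (powR_ge0 (n%:R : R) alpha).
rewrite -[Num.truncn _]/K u2 -natr1 in Ku uK.
have lK : l <= eta ^+ 2 * K%:R.
  have : 2 / alpha * u <= eta ^+ 2 * (u ^+ 2 - 1).
    have h : 2 / (alpha * eta ^+ 2) <= u - 1 by lra.
    have -> : eta ^+ 2 * (u ^+ 2 - 1) = eta ^+ 2 * (u - 1) * (u + 1) by ring.
    have -> : 2 / alpha * u = eta ^+ 2 * (2 / (alpha * eta ^+ 2)) * u.
      by field; rewrite !gt_eqF.
    apply: ler_pM.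
    - by rewrite mulr_ge0 ?sqr_ge0// divr_ge0// mulr_ge0 ?sqr_ge0// ltW.
    - exact: ltW.
    - by rewrite ler_wpM2l ?sqr_ge0.
    - by rewrite lerDl.
  have : eta ^+ 2 * (u ^+ 2 - 1) <= eta ^+ 2 * K%:R.
    by rewrite ler_wpM2l ?sqr_ge0//; lra.
  lra.
have Kn_alpha : K%:R <= n%:R `^ alpha :> R by rewrite u2.
have l8 : 8 <= l.
  apply: le_trans l1; rewrite ler_pdivlMr//; lra.
have K8 : 8 <= K%:R :> R.
  apply: le_trans l8 _; apply: le_trans lK _; rewrite ler_piMl// expr_le1//; lra.
have K0R : 0 < K%:R :> R by lra.
split => //.
- by rewrite -(ltr_nat R); lra.
- rewrite -(ler_nat R); apply: le_trans Kn_alpha _.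
  by rewrite -[leRHS]powRr1 ?(ltW n0)// ler_powR// ltW.
- rewrite -(ger0_norm (ltW eta0)) -sqrtr_sqr -sqrtrM ?sqr_ge0//.
  by rewrite ler_wsqrtr.
rewrite ln_div ?posrE// -/l.
have : ln K%:R <= alpha * l.
  by rewrite -ln_powR ler_ln ?posrE// powR_gt0.
have : 1 <= (1 - alpha) * l by rewrite mulrC -ler_pdivrMr// subr_gt0.
lra.
Qed.

Unset Implicit Arguments.

Theorem corollary2p5 (R : realType) (alpha : R)
    (alpha_gt0 : 0 < alpha) (alpha_lt1 : alpha < 1)
    (d : nat -> measure_display) (T : forall n, measurableType (d n))
    (P : forall n, probability (T n) R)
    (Z : forall n, edge n -> {RV (P n) >-> bool})
    (Z_iid : forall n, iid_bernoulli 2^-1 (Z n))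
    (eps : R) (eps_gt0 : 0 < eps) :
  P n [set w : T n |
        let K := subset_size alpha n in
        `| (Psi K (fun e => Z n e w))%:R
           - (K%:R ^+ 2 / 4
              + K%:R `^ (3 / 2) * Num.sqrt (ln (n%:R / K%:R)) / 2) |
        <= eps * (K%:R `^ (3 / 2) * Num.sqrt (ln n%:R))]
    @[n --> \oo] --> 1%E.
Proof.
pose K n := subset_size alpha n.
pose good n (z : {ffun edge n -> bool}) : bool :=
  `| (Psi (K n) z)%:R - ((K n)%:R ^+ 2 / 4
      + (K n)%:R `^ (3 / 2) * Num.sqrt (ln (n%:R / (K n)%:R)) / 2) |
        <= eps * ((K n)%:R `^ (3 / 2) * Num.sqrt (ln n%:R)).
have -> : (fun n => P n [set w : T n |
        let K := subset_size alpha n in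
        `| (Psi K (fun e => Z n e w))%:R
           - (K%:R ^+ 2 / 4
              + K%:R `^ (3 / 2) * Num.sqrt (ln (n%:R / K%:R)) / 2) |
        <= eps * (K%:R `^ (3 / 2) * Num.sqrt (ln n%:R))])
  = (fun n => (avg (fun z => (good n z)%:R : R))%:E).
  apply/funext => n; rewrite -(prob_avg (good n) (Z_iid n)); congr (P n _).
  apply/funext => w; rewrite /good /=.
  congr (is_true (`|(Psi _ _)%:R - _| <= _)).
  by apply/funext => e; rewrite ffunE.
apply/fine_cvgP; split; first exact: nearW.
have [eta [eta0 eta8 eta5 etaeps etaeps1]] := small_eta eps_gt0.
apply/cvgrPdist_le => delta delta0.
(* Every requirement on [n] is a lower bound on [ln n]; the last one makes each
   of the two tails at most [delta / 2]. *)
pose M : R := Num.max (Num.max (1 / eta) (4 / (alpha ^+ 2 * eta ^+ 2)))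
   (Num.max (1 / (1 - alpha)) (ln (2 / delta))).
near=> n.
have nM : expR M <= n%:R by near: n; exact: nbhs_infty_ger.
have n0 : 0 < n%:R :> R by apply: lt_le_trans nM; exact: expR_gt0.
have lM : M <= ln n%:R by rewrite -ler_expR lnK ?posrE.
move: lM; rewrite /M !ge_max => /andP[/andP[l1 l2] /andP[l3 l4]].
have [K1 Kn yw etal L1] := subset_size_facts alpha_gt0 alpha_lt1 eta0 eta8 l1 l2 l3.
have [[w0 w2 _] [y2 _ _ _]] := scales R K1 Kn.
have eps2 : 0 < eps ^+ 2 by rewrite exprn_gt0.
have l0 : 0 <= ln n%:R :> R by rewrite -y2 sqr_ge0.
have etaK : eta * ln n%:R <= eta * (K n)%:R.
  rewrite ler_wpM2l ?(ltW eta0)// -y2 -w2 lerXn2r ?nnegrE ?sqrtr_ge0//.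
  apply: le_trans yw _; rewrite ler_piMl ?sqrtr_ge0//; lra.
have hl : 1 <= 2 * eps ^+ 2 * ln n%:R.
  apply: le_trans etal _; rewrite ler_wpM2r//; lra.
have hK : 1 <= 2 * eps ^+ 2 * (K n)%:R.
  apply: le_trans (le_trans etal etaK) _; rewrite ler_wpM2r//; lra.
have up := Psi_upper K1 Kn eps_gt0 hl hK.
have lo := Psi_lower K1 Kn eps_gt0 eta0 eta8 eta5 etaeps etaeps1 yw etal L1.
have tail_le : expR (- ln n%:R) <= delta / 2.
  rewrite expRN lnK ?posrE//; rewrite -[delta / 2]invrK lef_pV2 ?posrE ?invr_gt0 ?divr_gt0//.
  rewrite invf_div -[2 / delta]lnK ?posrE ?divr_gt0//; apply: le_trans nM.
  by rewrite ler_expR /M !le_max lexx !orbT.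
set lower := avg _ in lo; set upper := avg _ in up.
rewrite /=; set A := avg _.
have A1 : A <= 1.
  rewrite /A -[leRHS](avg_cst (edge n)); apply: le_avg => z.
  by case: (good n z).
have cover : 1 <= A + upper + lower.
  rewrite -[leLHS](avg_cst (edge n)) -!avgD; apply: le_avg => z.
  have pos (b : bool) : 0 <= b%:R :> R by case: b.
  case: (boolP (good n z)) => [_|]; first by rewrite -addrA lerDl addr_ge0.
  rewrite /good powR_3half// -[X in X ^+ 2 / 4]w2.
  set W := Num.sqrt (K n)%:R; set a := W ^+ 3 * _ / 2; set b := W ^+ 3 * _.
  have -> : (W ^+ 2) ^+ 2 = W ^+ 4 by ring.
  rewrite -ltNge lter_normr => /orP[h|h].
    rewrite (_ : _ + a + _ < _ = true) ?add0r ?lerDl//; lra.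
  rewrite (_ : _ <= _ + a - _ = true) ?lerDr ?addr_ge0//; lra.
rewrite ger0_norm ?subr_ge0//; lra.
Unshelve. all: by end_near.
Qed.
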